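(* Let $T_1$ and $T_2$ be (finite) trees with vertex sets $X=\{x_1,\dots,x_{n_1}\}$ and $Y=\{y_1,\dots,y_{n_2}\}$ respectively, where $n_1,n_2\geqslant 2$. The partially commutative metabelian Lie rings $M(X;T_1)$ and $M(Y;T_2)$ (over $\mathbb{Z}$) are universally equivalent if and only if the graphs $T_1^*$ and $T_2^*$ are isomorphic.
   Context: A Lie ring is a Lie algebra over $\mathbb{Z}$; it is metabelian if $[[a,b],[c,d]]=0$ for all $a,b,c,d$. For a finite simple graph $G$ with vertex set $X$, $M(X;G)$ is the quotient of the free metabelian Lie ring on $X$ by the ideal generated by all $[x_i,x_j]$ with $\{x_i,x_j\}$ an edge of $G$. An endpoint of a graph is a vertex of degree $1$. For a tree $T$, $T^*$ denotes the subgraph of $T$ induced on the set of all vertices that are not endpoints (it may be empty). Two Lie rings are universally equivalent if they satisfy the same universal first-order sentences (a block of universal quantifiers followed by a quantifier-free formula, with no free variables and no constants from the rings) in the language of Lie rings (addition, negation, zero, Lie bracket); equivalently, if they satisfy the same existential sentences. *)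

(* Defs.v *)
From HB Require Import structures.
From mathcomp Require Import all_boot all_order all_algebra.
From mathcomp Require Import boolp.

Set Implicit Arguments.
Unset Strict Implicit.
Unset Printing Implicit Defensive.

Import GRing.Theory.
Local Open Scope ring_scope.
Local Open Scope quotient_scope.

(** ** Lie rings *)

HB.mixin Record isLieRing (L : Type) of GRing.Zmodule L := {
  lie : L -> L -> L;
  lieDl : forall x y z, lie (x + y) z = lie x z + lie y z;
  lieDr : forall x y z, lie x (y + z) = lie x y + lie x z;
  liexx : forall x, lie x x = 0;
  lie_jacobi : forall x y z,
    lie (lie x y) z + lie (lie y z) x + lie (lie z x) y = 0
}.

#[short(type="lieRingType")]
HB.structure Definition LieRing := {L of GRing.Zmodule L & isLieRing L}.

Definition metabelian (L : lieRingType) : Prop :=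
  forall a b c d : L, lie (lie a b) (lie c d) = 0.

Section LieTheory.
Variable L : lieRingType.
Implicit Types x y z : L.

Lemma lie0l x : lie 0 x = 0.
Proof. by apply: (addrI (lie 0 x)); rewrite -lieDl !addr0. Qed.

Lemma lier0 x : lie x 0 = 0.
Proof. by apply: (addrI (lie x 0)); rewrite -lieDr !addr0. Qed.

Lemma lieNl x y : lie (- x) y = - lie x y.
Proof. by apply/eqP; rewrite -addr_eq0 -lieDl addNr lie0l. Qed.

Lemma lieNr x y : lie x (- y) = - lie x y.
Proof. by apply/eqP; rewrite -addr_eq0 -lieDr addNr lier0. Qed.

Lemma lieBl x y z : lie (x - y) z = lie x z - lie y z.
Proof. by rewrite lieDl lieNl. Qed.

Lemma lieBr x y z : lie x (y - z) = lie x y - lie x z.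
Proof. by rewrite lieDr lieNr. Qed.

End LieTheory.

(** ** Ideals and quotients *)

HB.mixin Record isLieIdeal (L : lieRingType) (I : L -> bool) := {
  lie_ideall : forall a u : L, u \in I -> lie u a \in I;
  lie_idealr : forall a u : L, u \in I -> lie a u \in I
}.

#[short(type="lieIdeal")]
HB.structure Definition LieIdeal (L : lieRingType) :=
  {I of GRing.ZmodClosed L I & isLieIdeal L I}.

Section LieQuotient.
Variables (L : lieRingType) (I : lieIdeal L).
Local Notation Q := (Quotient.quot I).

Definition lie_quot : Q -> Q -> Q := lift_op2 Q (@lie L).

Lemma pi_lie_quot : {morph \pi : x y / lie x y >-> lie_quot x y}.
Proof.
move=> x y; unlock lie_quot; apply/eqP; rewrite piE Quotient.equivE.
have h (z : L) : z - repr (\pi_Q z) \in I.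
  by rewrite Quotient.idealrBE reprK.
rewrite -[lie x y](addrNK (lie x (repr (\pi_Q y)))) -lieBr -addrA -lieBl.
by apply: rpredD; [apply: lie_idealr | apply: lie_ideall]; exact: h.
Qed.
Canonical pi_lie_quot_morph := PiMorph2 pi_lie_quot.

Let piD (x y : L) : \pi_Q x + \pi_Q y = \pi_Q (x + y).
Proof. by rewrite !piE. Qed.

Let piL (x y : L) : lie_quot (\pi_Q x) (\pi_Q y) = \pi_Q (lie x y).
Proof. by rewrite pi_lie_quot. Qed.

Let pi0 : \pi_Q 0 = 0 :> Q.
Proof. by rewrite !piE. Qed.

Lemma lie_quotDl (x y z : Q) : lie_quot (x + y) z = lie_quot x z + lie_quot y z.
Proof. by rewrite -[x]reprK -[y]reprK -[z]reprK !(piD, piL) lieDl. Qed.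

Lemma lie_quotDr (x y z : Q) : lie_quot x (y + z) = lie_quot x y + lie_quot x z.
Proof. by rewrite -[x]reprK -[y]reprK -[z]reprK !(piD, piL) lieDr. Qed.

Lemma lie_quotxx (x : Q) : lie_quot x x = 0.
Proof. by rewrite -[x]reprK piL liexx pi0. Qed.

Lemma lie_quot_jacobi (x y z : Q) :
  lie_quot (lie_quot x y) z + lie_quot (lie_quot y z) x
  + lie_quot (lie_quot z x) y = 0.
Proof. by rewrite -[x]reprK -[y]reprK -[z]reprK !(piD, piL) lie_jacobi pi0. Qed.

HB.instance Definition _ := isLieRing.Build Q
  lie_quotDl lie_quotDr lie_quotxx lie_quot_jacobi.

End LieQuotient.

Section GeneratedIdeal.
Variables (L : lieRingType) (S : L -> Prop).

Definition lie_ideal_gen : {pred L} := fun x =>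
  `[< forall I : lieIdeal L, (forall s, S s -> s \in I) -> x \in I >].

Let genP x : reflect
  (forall I : lieIdeal L, (forall s, S s -> s \in I) -> x \in I)
  (x \in lie_ideal_gen).
Proof. exact: asboolP. Qed.

Lemma lie_ideal_gen_zmod_closed : zmod_closed lie_ideal_gen.
Proof.
split=> [|x y /genP Hx /genP Hy]; apply/genP => I HI; first exact: rpred0.
by rewrite rpredB ?Hx ?Hy.
Qed.

HB.instance Definition _ :=
  GRing.isZmodClosed.Build L lie_ideal_gen lie_ideal_gen_zmod_closed.

Lemma lie_ideal_gen_l (a u : L) : u \in lie_ideal_gen -> lie u a \in lie_ideal_gen.
Proof. by move=> /genP Hu; apply/genP => I HI; rewrite lie_ideall ?Hu. Qed.

Lemma lie_ideal_gen_r (a u : L) : u \in lie_ideal_gen -> lie a u \in lie_ideal_gen.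
Proof. by move=> /genP Hu; apply/genP => I HI; rewrite lie_idealr ?Hu. Qed.

HB.instance Definition _ :=
  isLieIdeal.Build L lie_ideal_gen lie_ideal_gen_l lie_ideal_gen_r.

End GeneratedIdeal.

(** ** Terms of the language of Lie rings *)

Inductive lterm (X : Type) : Type :=
| LVar of X
| LZero
| LAdd of lterm X & lterm X
| LOpp of lterm X
| LLie of lterm X & lterm X.

Arguments LZero {X}.

HB.instance Definition _ (X : Type) := gen_eqMixin (lterm X).
HB.instance Definition _ (X : Type) := gen_choiceMixin (lterm X).

Fixpoint lterm_eval (X : Type) (L : lieRingType) (v : X -> L) (t : lterm X) : L :=
  match t with
  | LVar x => v x
  | LZero => 0
  | LAdd t u => lterm_eval v t + lterm_eval v u
  | LOpp t => - lterm_eval v t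
  | LLie t u => lie (lterm_eval v t) (lterm_eval v u)
  end.

(** ** The free metabelian Lie ring *)

(* The equations between terms that follow from the axioms of metabelian Lie
   rings; the free metabelian Lie ring on X is the quotient of the terms over
   X by this congruence. *)
Inductive metab_eq (X : Type) : lterm X -> lterm X -> Prop :=
| MRefl t : metab_eq t t
| MSym t u : metab_eq t u -> metab_eq u t
| MTrans t u w : metab_eq t u -> metab_eq u w -> metab_eq t w
| MAdd t t' u u' :
    metab_eq t t' -> metab_eq u u' -> metab_eq (LAdd t u) (LAdd t' u')
| MOpp t t' : metab_eq t t' -> metab_eq (LOpp t) (LOpp t')
| MLie t t' u u' :
    metab_eq t t' -> metab_eq u u' -> metab_eq (LLie t u) (LLie t' u')
| MAddA t u w : metab_eq (LAdd t (LAdd u w)) (LAdd (LAdd t u) w)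
| MAddC t u : metab_eq (LAdd t u) (LAdd u t)
| MAdd0 t : metab_eq (LAdd LZero t) t
| MAddN t : metab_eq (LAdd (LOpp t) t) LZero
| MLieDl t u w :
    metab_eq (LLie (LAdd t u) w) (LAdd (LLie t w) (LLie u w))
| MLieDr t u w :
    metab_eq (LLie t (LAdd u w)) (LAdd (LLie t u) (LLie t w))
| MLiexx t : metab_eq (LLie t t) LZero
| MJacobi t u w :
    metab_eq (LAdd (LAdd (LLie (LLie t u) w) (LLie (LLie u w) t))
                   (LLie (LLie w t) u)) LZero
| MMetab a b c d : metab_eq (LLie (LLie a b) (LLie c d)) LZero.

Section FreeMetabelian.
Variable X : Type.

Definition metab_eqb (t u : lterm X) : bool := `[< metab_eq t u >].

Lemma metab_eqb_equiv : equiv_class_of metab_eqb.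
Proof.
split=> [t|t u|t u w].
- by apply/asboolP; exact: MRefl.
- by apply/asboolP/asboolP; exact: MSym.
- by move=> /asboolP h1 /asboolP h2; apply/asboolP; exact: MTrans h1 h2.
Qed.

Canonical metab_eqb_equivRel := EquivRelPack metab_eqb_equiv.
Canonical metab_eqb_encModRel := defaultEncModRel metab_eqb.

Definition free_metab := {eq_quot metab_eqb}.

HB.instance Definition _ := Choice.on free_metab.
HB.instance Definition _ : EqQuotient (lterm X) metab_eqb free_metab :=
  EqQuotient.on free_metab.

Definition fm_zero : free_metab := \pi_free_metab LZero.
Definition fm_add := lift_op2 free_metab (@LAdd X).
Definition fm_opp := lift_op1 free_metab (@LOpp X).
Definition fm_lie := lift_op2 free_metab (@LLie X).
Definition fm_var (x : X) : free_metab := \pi_free_metab (LVar x).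

Lemma fm_eqP (t u : lterm X) : metab_eq t u <-> \pi_free_metab t = \pi_free_metab u.
Proof.
split=> [h|/eqP]; last by rewrite piE => /asboolP.
by apply/eqP; rewrite piE; apply/asboolP.
Qed.

Let fm_repr (t : lterm X) : metab_eq (repr (\pi_free_metab t)) t.
Proof. by apply/fm_eqP; rewrite reprK. Qed.

Lemma fm_addE t u :
  fm_add (\pi_free_metab t) (\pi_free_metab u) = \pi_free_metab (LAdd t u).
Proof. by unlock fm_add; apply/fm_eqP/MAdd; exact: fm_repr. Qed.

Lemma fm_oppE t : fm_opp (\pi_free_metab t) = \pi_free_metab (LOpp t).
Proof. by unlock fm_opp; apply/fm_eqP/MOpp; exact: fm_repr. Qed.

Lemma fm_lieE t u :
  fm_lie (\pi_free_metab t) (\pi_free_metab u) = \pi_free_metab (LLie t u).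
Proof. by unlock fm_lie; apply/fm_eqP/MLie; exact: fm_repr. Qed.

Lemma fm_addA : associative fm_add.
Proof.
move=> x y z; rewrite -[x]reprK -[y]reprK -[z]reprK !fm_addE.
apply/fm_eqP; exact: MAddA.
Qed.

Lemma fm_addC : commutative fm_add.
Proof.
move=> x y; rewrite -[x]reprK -[y]reprK !fm_addE.
apply/fm_eqP; exact: MAddC.
Qed.

Lemma fm_add0 : left_id fm_zero fm_add.
Proof.
by move=> x; rewrite -[x]reprK /fm_zero fm_addE; apply/fm_eqP; exact: MAdd0.
Qed.

Lemma fm_addN : left_inverse fm_zero fm_opp fm_add.
Proof.
by move=> x; rewrite -[x]reprK fm_oppE fm_addE; apply/fm_eqP; exact: MAddN.
Qed.

HB.instance Definition _ :=
  GRing.isZmodule.Build free_metab fm_addA fm_addC fm_add0 fm_addN.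

Lemma fm_lieDl (x y z : free_metab) : fm_lie (x + y) z = fm_lie x z + fm_lie y z.
Proof.
rewrite -[x]reprK -[y]reprK -[z]reprK /GRing.add /=.
by rewrite !(fm_lieE, fm_addE); apply/fm_eqP; exact: MLieDl.
Qed.

Lemma fm_lieDr (x y z : free_metab) : fm_lie x (y + z) = fm_lie x y + fm_lie x z.
Proof.
rewrite -[x]reprK -[y]reprK -[z]reprK /GRing.add /=.
by rewrite !(fm_lieE, fm_addE); apply/fm_eqP; exact: MLieDr.
Qed.

Lemma fm_liexx (x : free_metab) : fm_lie x x = 0.
Proof. by rewrite -[x]reprK fm_lieE; apply/fm_eqP; exact: MLiexx. Qed.

Lemma fm_jacobi (x y z : free_metab) :
  fm_lie (fm_lie x y) z + fm_lie (fm_lie y z) x + fm_lie (fm_lie z x) y = 0.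
Proof.
rewrite -[x]reprK -[y]reprK -[z]reprK /GRing.add /=.
by rewrite !(fm_lieE, fm_addE); apply/fm_eqP; exact: MJacobi.
Qed.

HB.instance Definition _ := isLieRing.Build free_metab
  fm_lieDl fm_lieDr fm_liexx fm_jacobi.

End FreeMetabelian.

(** ** Graphs *)

Record sgraph (X : finType) := SGraph {
  adj :> rel X;
  adj_sym : symmetric adj;
  adj_irr : irreflexive adj
}.

Definition degree (X : finType) (G : sgraph X) (x : X) : nat :=
  #|[set y | adj G x y]|.

Definition endpoint (X : finType) (G : sgraph X) (x : X) : bool :=
  degree G x == 1%N.

Definition is_tree (X : finType) (G : sgraph X) : Prop :=
  (forall x y : X, connect (adj G) x y) /\
  (forall c : seq X, (2 < size c)%N -> ~ ucycle (adj G) c).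

Section Induced.
Variables (X : finType) (G : sgraph X) (A : {set X}).

Definition induced_adj : rel {x : X | x \in A} :=
  fun x y => adj G (val x) (val y).

Lemma induced_sym : symmetric induced_adj.
Proof. by move=> x y; exact: adj_sym. Qed.

Lemma induced_irr : irreflexive induced_adj.
Proof. by move=> x; exact: adj_irr. Qed.

Definition induced : sgraph {x : X | x \in A} := SGraph induced_sym induced_irr.

End Induced.

Definition star (X : finType) (T : sgraph X) :=
  induced T [set x | ~~ endpoint T x].

Definition graph_isomorphic (X Y : finType) (G : sgraph X) (H : sgraph Y) : Prop :=
  exists2 f : X -> Y, bijective f & {mono f : x y / adj G x y >-> adj H x y}.

(** ** Partially commutative metabelian Lie rings *)

Inductive edge_relator (X : finType) (G : sgraph X) : free_metab X -> Prop :=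
| EdgeRelator x y : adj G x y -> edge_relator G (lie (fm_var x) (fm_var y)).

Definition pc_metab (X : finType) (G : sgraph X) :=
  @Quotient.quot (free_metab X) (lie_ideal_gen (edge_relator G)).

HB.instance Definition _ (X : finType) (G : sgraph X) :=
  LieRing.on (pc_metab G).

(** ** Universal equivalence *)

Inductive qf_formula (V : Type) : Type :=
| QEq of lterm V & lterm V
| QNot of qf_formula V
| QAnd of qf_formula V & qf_formula V
| QOr of qf_formula V & qf_formula V
| QImp of qf_formula V & qf_formula V.

Fixpoint qf_holds (V : Type) (L : lieRingType) (v : V -> L)
    (phi : qf_formula V) : Prop :=
  match phi with
  | QEq t u => lterm_eval v t = lterm_eval v u
  | QNot phi => ~ qf_holds v phi
  | QAnd phi psi => qf_holds v phi /\ qf_holds v psi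
  | QOr phi psi => qf_holds v phi \/ qf_holds v psi
  | QImp phi psi => qf_holds v phi -> qf_holds v psi
  end.

(* forall v_0 ... v_(n-1), phi: all variables of phi lie in 'I_n, so that every
   one of them is bound by the quantifier block. *)
Record universal_sentence := UniversalSentence {
  us_arity : nat;
  us_matrix : qf_formula 'I_us_arity
}.

Definition us_holds (L : lieRingType) (s : universal_sentence) : Prop :=
  forall v : 'I_(us_arity s) -> L, qf_holds v (us_matrix s).

Definition universally_equivalent (L1 L2 : lieRingType) : Prop :=
  forall s : universal_sentence, us_holds L1 s <-> us_holds L2 s.

(* Main.v *)
From HB Require Import structures.
From mathcomp Require Import all_boot all_order all_algebra.
From mathcomp Require Import boolp.
From mathcomp Require Import mpoly ring fraction.
Require Import Defs.

(** The statement is first turned into one about homomorphisms.  A partially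
    commutative metabelian Lie ring has finitely many relators.  Hence, for [L]
    metabelian, [pc_metab G] inherits all universal sentences of [L] exactly
    when every finite set of its non-zero elements is kept away from zero by some
    homomorphism to [L] ([discriminates_us_holds], [us_holds_discriminates]).
    Universal equivalence is discrimination in both directions.

    Homomorphisms from [M := pc_metab G] to the ring of pairs [(s, w)] with
    bracket [(0, w s' - w' s)] are plentiful: they are given by vectors
    [(t x, w x)] that are parallel at adjacent vertices.  The ones used most are
    coloured: vertices outside a set [A] are killed, each [x] in [A] has its own
    variable, and [C] is a union of components of the subgraph induced on [A].
    They separate the points of [M], for the following reason.  In a multidegree
    with support [A], the derived ideal of [M] is generated by commutators
    [E i - E j], where [E] depends only on the component of its argument
    in [A]; so it is the reduced zeroth homology of the subgraph induced on [A],
    and the coloured representations are its coordinates ([part_eq0]).  Reduced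
    homology classes have coefficients that add up to zero, so that a non-zero
    one is seen by at least two components, and the component can be chosen
    away from any prescribed vertex ([crep_detect]).

    Suppose now that [pc_metab T1] is discriminated by [pc_metab T2].  For an
    inner vertex [i] of [T1], that is, not an endpoint, with neighbours [p] and [q], the commutator of [p]
    and [q] is killed by [i] and by no other vertex.  Over a forest, an element
    that kills a non-zero element of the derived ideal has for linear part zero or
    a multiple of a single vertex, and that vertex is not an endpoint: it has to
    touch two components that detect the element, and two vertices that do so
    close a cycle ([lie_eq0_vertex]).  A homomorphism that preserves finitely
    many inequations therefore sends inner vertices of [T1] to inner vertices of
    [T2], up to multiples and derived elements; the map is injective and
    preserves edges ([star_map]).  Two such maps in opposite directions are
    isomorphisms by counting.

    Conversely, an endpoint at a vertex [c] with two other neighbours [y1], [y2]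
    may be replaced by a generic integral combination of [y1] and [y2] without
    killing finitely many given elements ([absorb_avoids]): a component that
    avoids [c] lies on one side of [c], and touches at most one of [y1], [y2].
    After such replacements only so many endpoints are left at each inner vertex
    that they can be matched with endpoints of the other tree
    ([discriminates_of_inner_iso]). *)

Set Implicit Arguments.
Unset Strict Implicit.
Unset Printing Implicit Defensive.

Import GRing.Theory.
Local Open Scope ring_scope.
Local Open Scope quotient_scope.

(** * Homomorphisms of Lie rings *)

Definition lie_morph (L1 L2 : lieRingType) (f : L1 -> L2) : Prop :=
  {morph f : x y / x + y} /\ {morph f : x y / lie x y}.

Section LieMorphisms.
Variables (L1 L2 : lieRingType) (f : L1 -> L2) (hf : lie_morph f).

Lemma lie_morphD : {morph f : x y / x + y}. Proof. by case: hf. Qed.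
Lemma lie_morphL : {morph f : x y / lie x y}. Proof. by case: hf. Qed.

Lemma lie_morph0 : f 0 = 0.
Proof. by apply: (addrI (f 0)); rewrite -lie_morphD !addr0. Qed.

Lemma lie_morphN : {morph f : x / - x}.
Proof.
by move=> x; apply/eqP; rewrite -addr_eq0 -lie_morphD addNr lie_morph0.
Qed.

Lemma lie_morphB : {morph f : x y / x - y}.
Proof. by move=> x y; rewrite lie_morphD lie_morphN. Qed.

Lemma lie_morphMz n : {morph f : x / x *~ n}.
Proof.
move=> x; elim/int_ind: n => [|n IH|n IH]; first by rewrite !mulr0z lie_morph0.
- by rewrite -addn1 PoszD !mulrzDr !mulr1z lie_morphD IH.
- by rewrite -addn1 PoszD opprD !mulrzDr !mulrN1z lie_morphD lie_morphN IH.
Qed.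

Lemma lie_morphMn n : {morph f : x / x *+ n}.
Proof. by move=> x; rewrite !pmulrn lie_morphMz. Qed.

Lemma lie_morph_sum (I : Type) (r : seq I) (P : pred I) (F : I -> L1) :
  f (\sum_(i <- r | P i) F i) = \sum_(i <- r | P i) f (F i).
Proof. exact: (big_morph f lie_morphD lie_morph0). Qed.

Lemma lie_morph_eval (X : Type) (v : X -> L1) t :
  f (lterm_eval v t) = lterm_eval (f \o v) t.
Proof.
elim: t => //= [|t IHt u IHu|t IHt|t IHt u IHu].
- exact: lie_morph0.
- by rewrite lie_morphD IHt IHu.
- by rewrite lie_morphN IHt.
- by rewrite lie_morphL IHt IHu.
Qed.

End LieMorphisms.

Lemma lie_morph_comp (L1 L2 L3 : lieRingType) (g : L2 -> L3) (f : L1 -> L2) :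
  lie_morph g -> lie_morph f -> lie_morph (g \o f).
Proof.
move=> hg hf; split=> x y /=; first by rewrite (lie_morphD hf) (lie_morphD hg).
by rewrite (lie_morphL hf) (lie_morphL hg).
Qed.

Lemma lterm_eval_ext (X : Type) (L : lieRingType) (v w : X -> L) t :
  v =1 w -> lterm_eval v t = lterm_eval w t.
Proof.
by move=> h; elim: t => //= [t -> u ->|t ->|t -> u ->].
Qed.

Section LieKernel.
Variables (L1 L2 : lieRingType) (f : L1 -> L2).

(** The proof that [f] is a homomorphism is an argument, for the ideal structure to
    be inferred from the term alone. *)
Definition lie_ker (hf : lie_morph f) : {pred L1} := fun z => f z == 0.

Variable hf : lie_morph f.

Lemma lie_ker_zmod_closed : zmod_closed (lie_ker hf).
Proof.
split=> [|x y]; rewrite !unfold_in ?(lie_morph0 hf) //.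
by move=> /eqP hx /eqP hy; rewrite (lie_morphB hf) hx hy subrr.
Qed.
HB.instance Definition _ :=
  GRing.isZmodClosed.Build L1 (lie_ker hf) lie_ker_zmod_closed.

Lemma lie_ker_l (a u : L1) : u \in lie_ker hf -> lie u a \in lie_ker hf.
Proof. by rewrite !unfold_in (lie_morphL hf) => /eqP ->; rewrite lie0l. Qed.

Lemma lie_ker_r (a u : L1) : u \in lie_ker hf -> lie a u \in lie_ker hf.
Proof. by rewrite !unfold_in (lie_morphL hf) => /eqP ->; rewrite lier0. Qed.

HB.instance Definition _ := isLieIdeal.Build L1 (lie_ker hf) lie_ker_l lie_ker_r.

End LieKernel.

Section LieLinear.
Variable L : lieRingType.
Implicit Types x y z : L.

Lemma lieC x y : lie x y = - lie y x.
Proof.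
have := liexx (x + y); rewrite lieDl !lieDr !liexx add0r addr0.
by move/eqP; rewrite addr_eq0 => /eqP.
Qed.

Lemma lieMzl n x y : lie (x *~ n) y = lie x y *~ n.
Proof.
elim/int_ind: n => [|n IH|n IH]; first by rewrite !mulr0z lie0l.
- by rewrite -addn1 PoszD !mulrzDr !mulr1z lieDl IH.
- by rewrite -addn1 PoszD opprD !mulrzDr !mulrN1z lieDl lieNl IH.
Qed.

Lemma lieMnl n x y : lie (x *+ n) y = lie x y *+ n.
Proof. by rewrite !pmulrn lieMzl. Qed.

Lemma lieMzr n x y : lie x (y *~ n) = lie x y *~ n.
Proof. by rewrite lieC lieMzl -mulNrz -lieC. Qed.

Lemma lie_suml (I : Type) (r : seq I) (P : pred I) (F : I -> L) y :
  lie (\sum_(i <- r | P i) F i) y = \sum_(i <- r | P i) lie (F i) y.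
Proof.
by apply: (big_morph (fun x => lie x y)) => [a b|]; rewrite ?lieDl ?lie0l.
Qed.

Lemma lie_sumr (I : Type) (r : seq I) (P : pred I) (F : I -> L) y :
  lie y (\sum_(i <- r | P i) F i) = \sum_(i <- r | P i) lie y (F i).
Proof.
by apply: (big_morph (fun x => lie y x)) => [a b|]; rewrite ?lieDr ?lier0.
Qed.

(** The Jacobi identity in the form of the Leibniz rule for [fun u => lie u z]. *)
Lemma lie_leibniz x y z : lie (lie x y) z = lie (lie x z) y - lie (lie y z) x.
Proof.
apply/eqP; rewrite -subr_eq0 opprB addrA -lieNl -lieC.
by rewrite lie_jacobi.
Qed.

Lemma lie_lie_r x y z : lie x (lie y z) = lie (lie x y) z - lie (lie x z) y.
Proof. by rewrite (lie_leibniz x y z) addrAC subrr add0r -lieC. Qed.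

End LieLinear.

(** * The universal property of a partially commutative metabelian Lie ring *)

Section UniversalProperty.
Variables (X : finType) (G : sgraph X).
Local Notation M := (pc_metab G).

Definition pc_pi (z : free_metab X) : M := \pi z.
Definition pc_gen (x : X) : M := pc_pi (fm_var x).
Definition pc_term (z : M) : lterm X := repr (repr z).

Lemma pc_piD : {morph pc_pi : x y / x + y}.
Proof. by move=> x y; rewrite /pc_pi !piE. Qed.
Lemma pc_pi0 : pc_pi 0 = 0.
Proof. by rewrite /pc_pi !piE. Qed.
Lemma pc_piN : {morph pc_pi : x / - x}.
Proof. by move=> x; rewrite /pc_pi !piE. Qed.
Lemma pc_piL : {morph pc_pi : x y / lie x y}.
Proof. by move=> x y; rewrite /pc_pi pi_lie_quot. Qed.

Lemma pc_eval_gen t : lterm_eval pc_gen t = pc_pi (\pi_(free_metab X) t).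
Proof.
elim: t => //= [|t -> u ->|t ->|t -> u ->].
- by rewrite -pc_pi0.
- by rewrite -pc_piD -fm_addE.
- by rewrite -pc_piN -fm_oppE.
- by rewrite -pc_piL -fm_lieE.
Qed.

Lemma pc_termK z : lterm_eval pc_gen (pc_term z) = z.
Proof. by rewrite pc_eval_gen /pc_term reprK /pc_pi reprK. Qed.

Lemma pc_ind (P : M -> Prop) :
  (forall x, P (pc_gen x)) -> P 0 -> (forall a b, P a -> P b -> P (a + b)) ->
  (forall a, P a -> P (- a)) -> (forall a b, P a -> P b -> P (lie a b)) ->
  forall z, P z.
Proof.
move=> hx h0 hD hN hL z; rewrite -[z]pc_termK.
by elim: (pc_term z) => //= *; [exact: hD | exact: hN | exact: hL].
Qed.

Lemma pc_morph_ext (L : lieRingType) (f g : M -> L) :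
  lie_morph f -> lie_morph g -> (forall x, f (pc_gen x) = g (pc_gen x)) ->
  f =1 g.
Proof.
move=> hf hg h z; rewrite -[z]pc_termK (lie_morph_eval hf) (lie_morph_eval hg).
exact: lterm_eval_ext.
Qed.

Lemma pc_gen_comm x y : adj G x y -> lie (pc_gen x) (pc_gen y) = 0.
Proof.
move=> hxy; rewrite -pc_piL -pc_pi0 /pc_pi; apply/eqP.
rewrite piE Quotient.equivE subr0; apply/asboolP => I hI.
by apply: hI; constructor.
Qed.

Lemma pc_metabelian : metabelian M.
Proof.
move=> a b c d; rewrite -[a]pc_termK -[b]pc_termK -[c]pc_termK -[d]pc_termK.
set ta := pc_term a; set tb := pc_term b; set tc := pc_term c.
set td := pc_term d.
rewrite -[LHS]/(lterm_eval pc_gen (LLie (LLie ta tb) (LLie tc td))).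
rewrite pc_eval_gen -[RHS]/(lterm_eval pc_gen LZero) pc_eval_gen.
by congr (pc_pi _); apply/fm_eqP/MMetab.
Qed.

Lemma metab_eq_sound (L : lieRingType) (v : X -> L) t u :
  metabelian L -> metab_eq t u -> lterm_eval v t = lterm_eval v u.
Proof.
move=> hL; elim=> {t u} //=.
- by move=> t u w _ -> _ ->.
- by move=> t t' u u' _ -> _ ->.
- by move=> t t' _ ->.
- by move=> t t' u u' _ -> _ ->.
- by move=> *; rewrite addrA.
- by move=> *; rewrite addrC.
- by move=> *; rewrite add0r.
- by move=> *; rewrite addNr.
- by move=> *; rewrite lieDl.
- by move=> *; rewrite lieDr.
- by move=> *; rewrite liexx.
- by move=> *; rewrite lie_jacobi.
Qed.

(** Evaluation of a representative, so that the value exists for every [v]; it is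
    a homomorphism when [L] is metabelian and [v] respects the edges. *)
Definition pc_lift (L : lieRingType) (v : X -> L) (z : M) : L :=
  lterm_eval v (pc_term z).

Section Lift.
Variables (L : lieRingType) (v : X -> L).
Hypothesis hL : metabelian L.
Hypothesis hv : forall x y, adj G x y -> lie (v x) (v y) = 0.

Let lift (z : free_metab X) : L := lterm_eval v (repr z).

Let lift_pi t : lift (\pi t) = lterm_eval v t.
Proof. by apply: metab_eq_sound => //; apply/fm_eqP; rewrite reprK. Qed.

Let lift_morph : lie_morph lift.
Proof.
split=> x y; rewrite -[x]reprK -[y]reprK.
- by rewrite -[_ + _]/(fm_add _ _) fm_addE !lift_pi.
- by rewrite -[lie _ _]/(fm_lie _ _) fm_lieE !lift_pi.
Qed.

Let lift_ker z z' : pc_pi z = pc_pi z' -> lift z = lift z'.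
Proof.
move=> /eqP; rewrite /pc_pi piE Quotient.equivE => /asboolP /(_ (lie_ker lift_morph)).
move=> h; suff : z - z' \in lie_ker lift_morph.
  by rewrite unfold_in (lie_morphB lift_morph) subr_eq0 => /eqP.
apply: h => _ [x y hxy]; rewrite unfold_in (lie_morphL lift_morph).
by rewrite /fm_var !lift_pi /= hv.
Qed.

Lemma pc_lift_eval t : pc_lift v (lterm_eval pc_gen t) = lterm_eval v t.
Proof.
rewrite pc_eval_gen -[RHS]lift_pi /pc_lift -[LHS]/(lift (repr _)).
by apply: lift_ker; rewrite /pc_pi reprK.
Qed.

Lemma pc_lift_gen x : pc_lift v (pc_gen x) = v x.
Proof. exact: (pc_lift_eval (LVar x)). Qed.

Lemma pc_lift_morph : lie_morph (pc_lift v).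
Proof.
split=> x y; rewrite -[x]pc_termK -[y]pc_termK !pc_lift_eval.
- exact: (pc_lift_eval (LAdd _ _)).
- exact: (pc_lift_eval (LLie _ _)).
Qed.

End Lift.
End UniversalProperty.

Arguments pc_gen {X} G x.

(** * Universal sentences and discrimination *)

Definition discriminates (L1 L2 : lieRingType) : Prop :=
  forall s : seq L1, (forall u, u \in s -> u != 0) ->
  exists2 f : L1 -> L2, lie_morph f & forall u, u \in s -> f u != 0.

Fixpoint qf_atoms (V : Type) (L : lieRingType) (v : V -> L) (phi : qf_formula V)
    : seq L :=
  match phi with
  | QEq t u => [:: lterm_eval v t - lterm_eval v u]
  | QNot phi => qf_atoms v phi
  | QAnd phi psi => qf_atoms v phi ++ qf_atoms v psi
  | QOr phi psi => qf_atoms v phi ++ qf_atoms v psi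
  | QImp phi psi => qf_atoms v phi ++ qf_atoms v psi
  end.

Lemma qf_holds_morph (V : Type) (L1 L2 : lieRingType) (f : L1 -> L2)
    (v : V -> L1) phi :
  lie_morph f ->
  (forall u, u \in qf_atoms v phi -> u != 0 -> f u != 0) ->
  qf_holds (f \o v) phi <-> qf_holds v phi.
Proof.
move=> hf; have split_atoms (s1 s2 : seq L1) :
    (forall u, u \in s1 ++ s2 -> u != 0 -> f u != 0) ->
    (forall u, u \in s1 -> u != 0 -> f u != 0) /\
    (forall u, u \in s2 -> u != 0 -> f u != 0).
  by move=> h; split=> u hu; apply: h; rewrite mem_cat hu ?orbT.
elim: phi => /= [t u|phi IH|phi IH1 psi IH2|phi IH1 psi IH2|phi IH1 psi IH2].
- move=> h; rewrite -!(lie_morph_eval hf).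
  split=> [e|->] //; apply/eqP; rewrite -subr_eq0; apply/negPn/negP => ne.
  by have /negP := h _ (mem_head _ _) ne; rewrite (lie_morphB hf) e subrr eqxx.
- by move=> /IH ->.
- by move=> /split_atoms [/IH1 -> /IH2 ->].
- by move=> /split_atoms [/IH1 -> /IH2 ->].
- by move=> /split_atoms [/IH1 -> /IH2 ->].
Qed.

(** A counterexample in [L1] is governed by finitely many atoms, and a homomorphism
    that keeps their non-zero differences carries it over to [L2]. *)
Lemma discriminates_us_holds (L1 L2 : lieRingType) (s : universal_sentence) :
  discriminates L1 L2 -> us_holds L2 s -> us_holds L1 s.
Proof.
move=> hd h2 v; pose at0 := [seq u <- qf_atoms v (us_matrix s) | u != 0].
have [|f hf hnz] := hd at0; first by move=> u; rewrite mem_filter => /andP[].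
apply/(qf_holds_morph (f := f)) => // u hu nz.
by apply: hnz; rewrite mem_filter nz.
Qed.

Fixpoint lterm_map (X V : Type) (h : X -> V) (t : lterm X) : lterm V :=
  match t with
  | LVar x => LVar (h x)
  | LZero => LZero
  | LAdd t u => LAdd (lterm_map h t) (lterm_map h u)
  | LOpp t => LOpp (lterm_map h t)
  | LLie t u => LLie (lterm_map h t) (lterm_map h u)
  end.

Lemma lterm_eval_map (X V : Type) (L : lieRingType) (h : X -> V) (v : V -> L) t :
  lterm_eval v (lterm_map h t) = lterm_eval (v \o h) t.
Proof. by elim: t => //= [t -> u ->|t ->|t -> u ->]. Qed.

Lemma qf_holds_conj (I : eqType) (V : Type) (L : lieRingType) (v : V -> L)
    (r : seq I) (F : I -> qf_formula V) (psi : qf_formula V) :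
  qf_holds v (foldr (fun i => QAnd (F i)) psi r) <->
  (forall i, i \in r -> qf_holds v (F i)) /\ qf_holds v psi.
Proof.
elim: r => [|i r IH] /=; first by split=> [|[]].
split=> [[hi /IH [hr hpsi]]|[h hpsi]].
- by split=> // j; rewrite inE => /predU1P[->|/hr].
- split; first by apply: h; exact: mem_head.
  by apply/IH; split=> // j hj; apply: h; rewrite inE hj orbT.
Qed.

(** The relators of [G] are finite in number, so the diagram of the generators
    together with finitely many inequations is one existential sentence. *)
Lemma us_holds_discriminates (X : finType) (G : sgraph X) (L : lieRingType) :
  metabelian L ->
  (forall s, us_holds L s -> us_holds (pc_metab G) s) ->
  discriminates (pc_metab G) L.
Proof.
move=> hL hs s hnz.
pose tm (u : pc_metab G) := lterm_map (@enum_rank X) (pc_term u).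
pose vr x : lterm 'I_#|X| := LVar (enum_rank x).
pose edge (e : X * X) := QEq (LLie (vr e.1) (vr e.2)) LZero.
pose diag := foldr (fun u => QAnd (QNot (QEq (tm u) LZero)))
  (foldr (fun e => QAnd (edge e)) (QEq LZero LZero) [seq e <- enum {: X * X} | adj G e.1 e.2]) s.
have diagP (K : lieRingType) (v : 'I_#|X| -> K) : qf_holds v diag <->
    (forall u, u \in s -> lterm_eval (v \o enum_rank) (pc_term u) <> 0) /\
    (forall x y, adj G x y -> lie (v (enum_rank x)) (v (enum_rank y)) = 0).
  rewrite qf_holds_conj qf_holds_conj /=.
  split=> [[h1 [h2 _]]|[h1 h2]]; split=> //.
  - by move=> u /h1; rewrite lterm_eval_map.
  - by move=> x y hxy; apply: (h2 (x, y)); rewrite mem_filter hxy mem_enum.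
  - by move=> u /h1; rewrite lterm_eval_map.
  - by split=> // -[x y]; rewrite mem_filter => /andP[/h2].
apply: contrapT => hno.
suff : us_holds L (UniversalSentence (QNot diag)).
  move=> /hs /(_ (fun i => pc_gen G (enum_val i))) /=; apply; apply/diagP.
  have ev : (fun i => pc_gen G (enum_val i)) \o enum_rank =1 pc_gen G.
    by move=> x /=; rewrite enum_rankK.
  split=> [u /hnz /eqP|x y]; first by rewrite (lterm_eval_ext _ ev) pc_termK.
  by rewrite !enum_rankK; exact: pc_gen_comm.
move=> v /= /diagP [h1 h2]; apply: hno.
exists (pc_lift (v \o enum_rank)); first by apply: pc_lift_morph.
by move=> u /h1 /eqP.
Qed.

(** * Representations in wreath-type rings *)

(** The semidirect product of [R], as an abelian Lie ring, with [R] acting on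
    itself by multiplication: the target of a Magnus embedding. *)
Definition wreath (R : comNzRingType) : Type := (R * R)%type.

Section Wreath.
Variable R : comNzRingType.

HB.instance Definition _ := GRing.Zmodule.on (wreath R).

Definition wreath_lie (a b : wreath R) : wreath R := (0, a.2 * b.1 - b.2 * a.1).

Lemma wreath_lieDl a b c : wreath_lie (a + b) c = wreath_lie a c + wreath_lie b c.
Proof. by congr pair => /=; [rewrite addr0 | ring]. Qed.

Lemma wreath_lieDr a b c : wreath_lie a (b + c) = wreath_lie a b + wreath_lie a c.
Proof. by congr pair => /=; [rewrite addr0 | ring]. Qed.

Lemma wreath_liexx a : wreath_lie a a = 0.
Proof. by congr pair => /=; ring. Qed.

Lemma wreath_jacobi a b c :
  wreath_lie (wreath_lie a b) c + wreath_lie (wreath_lie b c) a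
  + wreath_lie (wreath_lie c a) b = 0.
Proof. by congr pair => /=; [rewrite !addr0 | ring]. Qed.

HB.instance Definition _ := isLieRing.Build (wreath R)
  wreath_lieDl wreath_lieDr wreath_liexx wreath_jacobi.

Lemma wreath_lieE (a b : wreath R) : lie a b = (0, a.2 * b.1 - b.2 * a.1).
Proof. by []. Qed.

Lemma wreath_metabelian : metabelian (wreath R).
Proof.
by move=> a b c d; rewrite !wreath_lieE /=; congr pair; rewrite !mulr0 subrr.
Qed.

Lemma wreath_Mn (a b : R) n : ((a, b) : wreath R) *+ n = (a *+ n, b *+ n).
Proof. by elim: n => // n IH; rewrite mulrS IH !mulrS. Qed.

End Wreath.

Section WreathMap.
Variables (R S : comNzRingType) (f : {rmorphism R -> S}).

Definition wreath_map (a : wreath R) : wreath S := (f a.1, f a.2).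

Lemma wreath_map_morph : lie_morph wreath_map.
Proof.
split=> a b; first by rewrite /wreath_map !rmorphD.
by rewrite /wreath_map !wreath_lieE /= rmorph0 rmorphB !rmorphM.
Qed.

End WreathMap.

Section WreathRep.
Variables (X : finType) (G : sgraph X).
Local Notation M := (pc_metab G).

(** The points [(t x, w x)] and [(t y, w y)] are proportional, so that their bracket
    in [wreath R] is zero. *)
Definition compat (R : comNzRingType) (t w : X -> R) : Prop :=
  forall x y, adj G x y -> w x * t y = w y * t x.

Definition wrep (R : comNzRingType) (t w : X -> R) : M -> wreath R :=
  pc_lift (fun x => (t x, w x) : wreath R).

Lemma compat0 (R : comNzRingType) (t : X -> R) : compat t (fun=> 0).
Proof. by move=> x y _; rewrite !mul0r. Qed.

Section Rep.
Variables (R : comNzRingType) (t w : X -> R).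
Hypothesis htw : compat t w.

Lemma wrep_morph : lie_morph (wrep t w).
Proof.
apply: pc_lift_morph; first exact: wreath_metabelian.
by move=> x y hxy; rewrite wreath_lieE /= htw // subrr.
Qed.

Lemma wrep_gen x : wrep t w (pc_gen G x) = (t x, w x).
Proof.
apply: (pc_lift_gen (L := wreath R)); first exact: wreath_metabelian.
by move=> a b hab; rewrite wreath_lieE /= htw // subrr.
Qed.

End Rep.

Lemma wrep_map (R S : comNzRingType) (f : {rmorphism R -> S}) (t w : X -> R) z :
  compat t w ->
  wrep (f \o t) (f \o w) z = wreath_map f (wrep t w z).
Proof.
move=> h.
have h' : compat (f \o t) (f \o w).
  by move=> x y hxy /=; rewrite -!rmorphM h.
apply: (pc_morph_ext (wrep_morph h')
  (lie_morph_comp (wreath_map_morph f) (wrep_morph h))) => x /=.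
by rewrite !wrep_gen.
Qed.

Lemma wrep_ext (R : comNzRingType) (t w t' w' : X -> R) z :
  t =1 t' -> w =1 w' -> wrep t w z = wrep t' w' z.
Proof.
by move=> ht hw; apply: lterm_eval_ext => x; rewrite ht hw.
Qed.

(** * Linear parts *)

(** The coordinate at [x] in the abelianisation, which is free on the vertices. *)
Definition lin (x : X) (z : M) : int :=
  (wrep (fun y => (y == x)%:R) (fun=> 0) z).1.

Lemma linD x : {morph lin x : a b / a + b}.
Proof. by move=> a b; rewrite /lin (lie_morphD (wrep_morph (@compat0 _ _))). Qed.

Lemma lin0 x : lin x 0 = 0.
Proof. by rewrite /lin (lie_morph0 (wrep_morph (@compat0 _ _))). Qed.

Lemma linN x : {morph lin x : a / - a}.
Proof. by move=> a; rewrite /lin (lie_morphN (wrep_morph (@compat0 _ _))). Qed.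

Lemma linB x : {morph lin x : a b / a - b}.
Proof. by move=> a b; rewrite linD linN. Qed.

Lemma lin_lie x a b : lin x (lie a b) = 0.
Proof. by rewrite /lin (lie_morphL (wrep_morph (@compat0 _ _))). Qed.

Lemma lin_gen x y : lin x (pc_gen G y) = (y == x)%:R.
Proof. by rewrite /lin wrep_gen //; exact: compat0. Qed.

Lemma linMz x n a : lin x (a *~ n) = lin x a * n.
Proof.
elim/int_ind: n => [|n IH|n IH]; first by rewrite mulr0z lin0 mulr0.
- by rewrite -addn1 PoszD mulrzDr mulr1z linD IH mulrDr mulr1.
- by rewrite -addn1 PoszD opprD mulrzDr mulrN1z linD linN IH mulrDr mulrN1.
Qed.

Lemma wrep_fst (R : comNzRingType) (t w : X -> R) z :
  compat t w -> (wrep t w z).1 = \sum_x t x * (lin x z)%:~R.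
Proof.
move=> h; elim/pc_ind: z => [y||a b ha hb|a ha|a b _ _].
- rewrite wrep_gen // (bigD1 y) //= lin_gen eqxx mulr1 big1 ?addr0 // => x.
  by rewrite lin_gen eq_sym => /negbTE ->; rewrite mulr0.
- rewrite (lie_morph0 (wrep_morph h)) big1 // => x _.
  by rewrite lin0 mulr0.
- rewrite (lie_morphD (wrep_morph h)) /= ha hb -big_split /=.
  by apply: eq_bigr => x _; rewrite linD rmorphD mulrDr.
- rewrite (lie_morphN (wrep_morph h)) /= ha -sumrN.
  by apply: eq_bigr => x _; rewrite linN rmorphN mulrN.
- rewrite (lie_morphL (wrep_morph h)) /= big1 // => x _.
  by rewrite lin_lie mulr0.
Qed.

(** * Left-normed commutators span the derived ideal *)

Definition act (u : M) (m : seq X) : M := foldl (fun v x => lie v (pc_gen G x)) u m.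

Definition lnc (k : X * X * seq X) : M :=
  act (lie (pc_gen G k.1.1) (pc_gen G k.1.2)) k.2.

Definition lnc_span (u : M) : Prop := exists s, u = \sum_(k <- s) lnc k.

Lemma actD m : {morph act^~ m : u v / u + v}.
Proof. by elim: m => //= x m IH u v; rewrite lieDl IH. Qed.

Lemma act0 m : act 0 m = 0.
Proof. by elim: m => //= x m IH; rewrite lie0l. Qed.

Lemma actN m : {morph act^~ m : u / - u}.
Proof. by elim: m => //= x m IH u; rewrite lieNl IH. Qed.

Lemma lnc_spanD u v : lnc_span u -> lnc_span v -> lnc_span (u + v).
Proof. by move=> [s ->] [s' ->]; exists (s ++ s'); rewrite big_cat. Qed.

Lemma lnc_span0 : lnc_span 0.
Proof. by exists [::]; rewrite big_nil. Qed.

Lemma lnc_spanN u : lnc_span u -> lnc_span (- u).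
Proof.
move=> [s ->]; exists [seq (k.1.2, k.1.1, k.2) | k <- s].
by rewrite big_map -sumrN; apply: eq_bigr => k _; rewrite /lnc /= [in LHS]lieC actN opprK.
Qed.

Lemma lnc_span_lie_gen u x : lnc_span u -> lnc_span (lie u (pc_gen G x)).
Proof.
move=> [s ->]; exists [seq (k.1, rcons k.2 x) | k <- s].
rewrite big_map lie_suml; apply: eq_bigr => k _.
by rewrite /lnc /act /= foldl_rcons.
Qed.

Lemma lnc_span_liel u z : lnc_span u -> lnc_span (lie u z).
Proof.
elim/pc_ind: z u => [x u|u|a b ha hb u|a ha u|a b ha hb u] hu.
- exact: lnc_span_lie_gen.
- by rewrite lier0; exact: lnc_span0.
- by rewrite lieDr; apply: lnc_spanD; [exact: ha | exact: hb].
- by rewrite lieNr; apply: lnc_spanN; exact: ha.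
- rewrite lie_lie_r; apply: lnc_spanD; first by apply: hb; exact: ha.
  by apply: lnc_spanN; apply: ha; exact: hb.
Qed.

Lemma lnc_span_lie a b : lnc_span (lie a b).
Proof.
elim/pc_ind: a b => [x z|z|a b ha hb z|a ha z|a b ha _ z].
- elim/pc_ind: z => [y||a b ha hb|a ha|a b ha hb].
  + by exists [:: (x, y, [::])]; rewrite big_seq1.
  + by rewrite lier0; exact: lnc_span0.
  + by rewrite lieDr; exact: lnc_spanD.
  + by rewrite lieNr; exact: lnc_spanN.
  + rewrite lie_lie_r; apply: lnc_spanD; first exact: lnc_span_liel.
    by apply: lnc_spanN; exact: lnc_span_liel.
- by rewrite lie0l; exact: lnc_span0.
- by rewrite lieDl; exact: lnc_spanD.
- by rewrite lieNl; exact: lnc_spanN.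
- by apply: lnc_span_liel; exact: ha.
Qed.

Lemma lin_decomp z : lnc_span (z - \sum_x pc_gen G x *~ lin x z).
Proof.
elim/pc_ind: z => [y||a b ha hb|a ha|a b _ _].
- rewrite (bigD1 y) //= lin_gen eqxx mulr1z big1 ?addr0 => [|x].
    by rewrite subrr; exact: lnc_span0.
  by rewrite lin_gen eq_sym => /negbTE ->; rewrite mulr0z.
- rewrite big1 ?subrr => [|x _]; first exact: lnc_span0.
  by rewrite lin0 mulr0z.
- have -> : \sum_x pc_gen G x *~ lin x (a + b) =
      \sum_x pc_gen G x *~ lin x a + \sum_x pc_gen G x *~ lin x b.
    by rewrite -big_split; apply: eq_bigr => x _; rewrite linD mulrzDr.
  by rewrite opprD addrACA; exact: lnc_spanD.
- have -> : \sum_x pc_gen G x *~ lin x (- a) = - \sum_x pc_gen G x *~ lin x a.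
    by rewrite -sumrN; apply: eq_bigr => x _; rewrite linN mulrNz.
  by rewrite -opprD; exact: lnc_spanN.
- rewrite big1 ?subr0 => [|x _]; first exact: lnc_span_lie.
  by rewrite lin_lie mulr0z.
Qed.

Lemma lin0_span u : (forall x, lin x u = 0) -> lnc_span u.
Proof.
move=> h; have := lin_decomp u; rewrite big1 ?subr0 // => x _.
by rewrite h mulr0z.
Qed.

Lemma lnc_is_lie k : exists a b, lnc k = lie a b.
Proof.
case: k => [[i j] m]; rewrite /lnc /=; elim/last_ind: m => [|m x _].
  by exists (pc_gen G i), (pc_gen G j).
by rewrite /act foldl_rcons; eexists; eexists.
Qed.

(** Elements without linear part are in the derived ideal, which is abelian. *)
Lemma lin0_comm u v :
  (forall x, lin x u = 0) -> (forall x, lin x v = 0) -> lie u v = 0.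
Proof.
move=> /lin0_span [s ->] /lin0_span [s' ->].
rewrite lie_suml big1 // => k _; rewrite lie_sumr big1 // => k' _.
have [a [b ->]] := lnc_is_lie k; have [c [d ->]] := lnc_is_lie k'.
exact: pc_metabelian.
Qed.

(** By the Leibniz rule the two orders differ by the action of a commutator on an
    element of the abelian derived ideal. *)
Lemma act_comm u a b : (forall x, lin x u = 0) ->
  lie (lie u a) b = lie (lie u b) a.
Proof.
move=> hu; rewrite lie_leibniz [X in _ - X]lin0_comm ?subr0 // => x.
exact: lin_lie.
Qed.

Lemma act_cat_cons u m1 x m2 : (forall y, lin y u = 0) ->
  act u (m1 ++ x :: m2) = act u (x :: m1 ++ m2).
Proof.
elim: m1 u => //= y m1 IH u hu.
by rewrite IH => [|z]; rewrite ?lin_lie //= act_comm.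
Qed.

Lemma act_perm u m m' : (forall y, lin y u = 0) ->
  perm_eq m m' -> act u m = act u m'.
Proof.
elim: m u m' => [|x m IH] u m' hu.
  by move=> /perm_size /esym/size0nil ->.
move=> hp; have hx : x \in m' by rewrite -(perm_mem hp) mem_head.
case/splitPr: hx hp => m1 m2.
rewrite perm_sym perm_catC /= perm_cons => hp.
rewrite act_cat_cons //=; apply: IH => [y|]; first exact: lin_lie.
by rewrite perm_sym perm_catC.
Qed.

Lemma lnc_perm i j m m' : perm_eq m m' -> lnc (i, j, m) = lnc (i, j, m').
Proof. by apply: act_perm => y; exact: lin_lie. Qed.

End WreathRep.

(** * Coloured representations detect every element *)

Section Colourings.
Variables (X : finType) (G : sgraph X).
Local Notation M := (pc_metab G).

Definition adj_in (A : {set X}) : rel X :=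
  fun x y => [&& x \in A, y \in A & adj G x y].

Lemma adj_in_sym A x y : adj_in A x y = adj_in A y x.
Proof. by rewrite /adj_in adj_sym andbCA. Qed.

Lemma connect_adj_in_sym A : connect_sym (adj_in A).
Proof. exact: sym_connect_sym (adj_in_sym A). Qed.

Lemma connect_adj_in_mem A x y :
  connect (adj_in A) x y -> (x \in A) = (y \in A).
Proof.
by apply: closed_connect => {}x {}y /and3P[-> ->].
Qed.

Definition comp_of (A : {set X}) (x : X) : {set X} :=
  [set y | connect (adj_in A) x y].

(** The part of [C] inside [A] is a union of connected components of the subgraph
    induced on [A]. *)
Definition colouring (A C : {set X}) : Prop :=
  forall x y, x \in A -> y \in A -> adj G x y -> (x \in C) = (y \in C).

Lemma colouring_comp A x : colouring A (comp_of A x).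
Proof.
move=> y z hy hz hyz; rewrite !inE.
by apply: same_connect_r; [exact: connect_adj_in_sym | apply: connect1; apply/and3P].
Qed.

Section Crep.
Variables (R : comNzRingType) (tau : X -> R).

(** Vertices of [A] in [C] go to the diagonal, the others to the first axis, and the
    vertices outside [A] to zero. *)
Definition colt (A : {set X}) (x : X) : R := if x \in A then tau x else 0.
Definition colw (A C : {set X}) (x : X) : R := if x \in C then colt A x else 0.
Definition crep (A C : {set X}) : M -> wreath R := wrep (colt A) (colw A C).

Lemma colouring_compat A C : colouring A C -> compat G (colt A) (colw A C).
Proof.
move=> h x y hxy; rewrite /colw /colt.
have [hx|_] := boolP (x \in A); last by rewrite if_same mulr0 mul0r.
have [hy|_] := boolP (y \in A); last by rewrite if_same mulr0 mul0r.
by rewrite (h x y) //; case: ifP; rewrite ?mul0r // mulrC.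
Qed.

(** Up to a monomial, this is the value at [C] of the formal difference of the first
    two letters, seen as a zero-chain of the graph. *)
Lemma crep_lnc A C k : colouring A C ->
  (crep A C (lnc G k)).2 =
  ((k.1.1 \in C)%:R - (k.1.2 \in C)%:R)
  * \prod_(x <- k.1.1 :: k.1.2 :: k.2) colt A x.
Proof.
move=> h; have hc := colouring_compat h.
case: k => [[i j] m] /=; rewrite !big_cons mulrA.
have act2 u : (forall x, lin x u = 0) ->
    (crep A C (act u m)).2 = (crep A C u).2 * \prod_(x <- m) colt A x.
  elim: m u => [|x m IH] u hu /=; first by rewrite big_nil mulr1.
  rewrite IH => [|y]; last exact: lin_lie.
  rewrite big_cons mulrA /crep (lie_morphL (wrep_morph hc)) wreath_lieE /=.
  rewrite wrep_gen //= [X in _ - _ * X]wrep_fst // big1 ?mulr0 ?subr0 // => y _.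
  by rewrite hu mulr0.
rewrite /lnc /= act2 => [|x]; last exact: lin_lie.
rewrite /crep (lie_morphL (wrep_morph hc)) wreath_lieE !wrep_gen //= /colw.
by case: (i \in C); case: (j \in C) => /=; ring.
Qed.

End Crep.

Definition var (x : X) : {mpoly int[#|X|]} := 'X_(enum_rank x).

Definition mono (s : seq X) : 'X_{1.. #|X|} :=
  (\big[mnm_add/0%MM]_(x <- s) U_(enum_rank x))%MM.

Lemma monoE s x : mono s (enum_rank x) = count_mem x s.
Proof.
rewrite /mono mnm_sumE; elim: s => [|y s IH] /=; first by rewrite big_nil.
by rewrite big_cons IH mnm1E (inj_eq enum_rank_inj).
Qed.

Lemma mono_perm s s' : mono s = mono s' -> perm_eq s s'.
Proof. by move=> h; apply/allP => x _ /=; rewrite -!monoE h. Qed.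

Lemma prod_var s : \prod_(x <- s) var x = 'X_[mono s].
Proof.
rewrite /mono /var; elim: s => [|x s IH]; first by rewrite !big_nil mpolyX0.
by rewrite !big_cons IH mpolyXD.
Qed.

Definition msupport (d : 'X_{1.. #|X|}) : {set X} :=
  [set x | d (enum_rank x) != 0%N].

Lemma mem_msupport s x : (x \in msupport (mono s)) = (x \in s).
Proof. by rewrite inE monoE -lt0n -has_count has_pred1. Qed.

(** The word of a left-normed commutator, whose content is its multidegree. *)
Definition word (k : X * X * seq X) : seq X := k.1.1 :: k.1.2 :: k.2.

Lemma crep_lnc_coef d C k : colouring (msupport d) C ->
  (crep var (msupport d) C (lnc G k)).2@_d =
  if mono (word k) == d then (k.1.1 \in C)%:R - (k.1.2 \in C)%:R else 0.
Proof.
move=> h; rewrite crep_lnc // -/(word k).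
have -> : ((k.1.1 \in C)%:R - (k.1.2 \in C)%:R : {mpoly int[#|X|]})
    = ((k.1.1 \in C)%:R - (k.1.2 \in C)%:R)%:MP.
  by rewrite mpolyCB !mpolyC_nat.
rewrite mcoeffCM; have [hall|] := boolP (all (mem (msupport d)) (word k)).
  rewrite (eq_big_seq var) => [|x hx]; last first.
    by have := allP hall _ hx; rewrite /colt /= => ->.
  by rewrite prod_var mcoeffX; case: ifP; rewrite ?mulr1 ?mulr0.
move=> /allPn [x hx hxd]; case: eqP => [e|_].
  by move: hxd; rewrite /= -e mem_msupport hx.
rewrite (big_rem x) //= /colt.
by move: hxd => /= /negbTE ->; rewrite mul0r mcoeff0 mulr0.
Qed.

Section Homogeneous.
Variables (s : seq (X * X * seq X)) (d : 'X_{1.. #|X|}).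
Local Notation A := (msupport d).
Local Notation part := (\sum_(k <- s | mono (word k) == d) lnc G k).

(** With [E x] the left-normed commutator of multidegree [d] that starts with
    [x, b], the Jacobi identity gives [E i - E j] for the one that starts with
    [i, j].  Adjacent vertices commute, so [E] is constant on components, and the
    homogeneous part is a sum over components of values of [E] with integer
    multiplicities.  The multiplicity at a component is the coefficient at [d] of
    a coloured representation; the component of [b] needs none, since [E b] is
    zero. *)
Lemma part_eq0 (a0 : X) :
  (forall x0, x0 \in A -> ~~ connect (adj_in A) a0 x0 ->
     (crep var A (comp_of A x0) (\sum_(k <- s) lnc G k)).2 = 0) ->
  part = 0.
Proof.
move=> hyp.
case: (boolP (has (fun k => mono (word k) == d) s)) => [|hn]; last first.
  rewrite big_seq_cond big_pred0 // => k; apply/andP => -[hk e].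
  by case/hasP: hn; exists k.
case/hasP => k0 _ /eqP hk0; pose sd := word k0.
have memA x : (x \in A) = (x \in sd) by rewrite -hk0 mem_msupport.
(* The base point lies in the component of [a0] when [a0] is in [A], as nothing is
   assumed about that component. *)
pose b := if a0 \in A then a0 else k0.1.1.
have bA : b \in A by rewrite /b; case: ifP => // _; rewrite memA mem_head.
pose E x := if x == b then 0 else lnc G (x, b, rem b (rem x sd)).
have perm_rem2 x y m : perm_eq (x :: y :: m) sd -> perm_eq m (rem y (rem x sd)).
  move=> hp; have hx : x \in sd by rewrite -(perm_mem hp) mem_head.
  have hp1 : perm_eq (y :: m) (rem x sd).
    by rewrite -(perm_cons x) (perm_trans hp) ?perm_to_rem.
  have hy : y \in rem x sd by rewrite -(perm_mem hp1) mem_head.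
  by rewrite -(perm_cons y) (perm_trans hp1) ?perm_to_rem.
have EB i j m : perm_eq (word (i, j, m)) sd -> lnc G (i, j, m) = E i - E j.
  rewrite /word /= => hp; rewrite /E.
  have [->|nij] := eqVneq i j.
    by rewrite subrr /lnc /= liexx act0.
  have [ei|nib] := eqVneq i b.
    rewrite -ei eq_sym (negbTE nij) sub0r.
    rewrite (@lnc_perm _ G i j _ (rem i (rem j sd))).
      by rewrite /lnc /= [in LHS]lieC actN.
    apply: perm_rem2; apply: perm_trans hp.
    by rewrite -[j :: i :: m]/([:: j] ++ [:: i] ++ m) perm_catCA.
  have [ej|njb] := eqVneq j b.
    by rewrite -ej subr0; apply: lnc_perm; exact: perm_rem2.
  have bm : b \in m.
    have : b \in sd by rewrite -memA.
    by rewrite -(perm_mem hp) !inE ![b == _]eq_sym (negbTE nib) (negbTE njb).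
  have hm : perm_eq m (b :: rem b m) by exact: perm_to_rem.
  rewrite (lnc_perm G i j hm) (@lnc_perm _ G i b _ (j :: rem b m)); last first.
    rewrite perm_sym; apply: perm_rem2; apply: perm_trans hp.
    rewrite perm_cons -[b :: j :: _]/([:: b] ++ [:: j] ++ _) perm_catCA /=.
    by rewrite perm_cons perm_sym.
  rewrite [X in _ - X](@lnc_perm _ G j b _ (i :: rem b m)); last first.
    rewrite perm_sym; apply: perm_rem2; apply: perm_trans hp.
    rewrite -[j :: b :: i :: _]/([:: j; b] ++ [:: i] ++ _) perm_catCA /=.
    by rewrite perm_cons perm_cons perm_sym.
  by rewrite /lnc /= lie_leibniz actD actN.
have Eadj x y : adj_in A x y -> E x = E y.
  case/and3P; rewrite !memA => hx hy hxy; apply/eqP; rewrite -subr_eq0.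
  rewrite -(EB x y (rem y (rem x sd))).
    by rewrite /lnc /= (pc_gen_comm hxy) act0.
  rewrite perm_sym (perm_trans (perm_to_rem hx)) // perm_cons perm_to_rem //.
  have nxy : y != x by apply: contraTneq hxy => ->; rewrite adj_irr.
  by move: hy; rewrite (perm_mem (perm_to_rem hx)) inE (negbTE nxy).
have Econn x y : connect (adj_in A) x y -> E x = E y.
  case/connectP => p; elim: p x => [|z p IH] x /=; first by move=> _ ->.
  by case/andP => /Eadj -> /IH h /h.
pose c x : int :=
  \sum_(k <- s | mono (word k) == d) ((x == k.1.1)%:R - (x == k.1.2)%:R).
have cA x : x \notin A -> c x = 0.
  move=> hx; rewrite /c big1 // => k /eqP hk; move: hx; rewrite -hk mem_msupport.
  by rewrite !inE => /norP[/negbTE -> /norP[/negbTE -> _]]; rewrite subrr.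
have -> : part = \sum_x E x *~ c x.
  transitivity (\sum_(k <- s | mono (word k) == d)
                 \sum_x E x *~ ((x == k.1.1)%:R - (x == k.1.2)%:R)).
    apply: eq_bigr => -[[i j] m] /eqP hk; rewrite EB; last first.
      by apply: mono_perm; rewrite hk hk0.
    have pick y : \sum_x E x *~ (x == y)%:R = E y.
      rewrite (bigD1 y) //= eqxx mulr1z big1 ?addr0 // => x /negbTE ->.
      by rewrite mulr0z.
    rewrite -[in LHS](pick i) -[in LHS](pick j) -sumrB.
    by apply: eq_bigr => x _; rewrite mulrzBr.
  rewrite exchange_big /=; apply: eq_bigr => x _; rewrite /c.
  by elim/big_rec2: _ => [|k u v _ ->]; rewrite ?mulr0z // -mulrzDr.
rewrite (partition_big (fingraph.root (adj_in A)) predT) //= big1 // => r _.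
have [rr|nr] := eqVneq (fingraph.root (adj_in A) r) r; last first.
  apply: big_pred0 => x; apply: contraNF nr => /eqP <-.
  by rewrite root_root //; exact: connect_adj_in_sym.
have rootE x : (fingraph.root (adj_in A) x == r) = (x \in comp_of A r).
  rewrite inE -[in LHS]rr root_connect; last exact: connect_adj_in_sym.
  by rewrite connect_adj_in_sym.
rewrite (eq_bigr (fun x => E r *~ c x)); last first.
  by move=> x; rewrite rootE inE => /Econn ->.
rewrite -mulrz_sumr.
have [rA|rA] := boolP (r \in A); last first.
  rewrite big1 ?mulr0z // => x; rewrite rootE inE => /connect_adj_in_mem e.
  by apply: cA; rewrite -e.
have [har|har] := boolP (connect (adj_in A) a0 r).
  have a0A : a0 \in A by rewrite (connect_adj_in_mem har).
  by rewrite -(Econn _ _ har) /E /b a0A eqxx mul0rz.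
have := hyp r rA har; move/(congr1 (mcoeff d)); rewrite mcoeff0.
rewrite /crep (lie_morph_sum (wrep_morph (colouring_compat var (@colouring_comp A r)))).
have -> (F : X * X * seq X -> wreath {mpoly int[#|X|]}) :
    (\sum_(k <- s) F k).2 = \sum_(k <- s) (F k).2.
  exact: (big_morph (fun z : wreath _ => z.2)).
rewrite raddf_sum /= (eq_bigr _ (fun k _ => crep_lnc_coef _ (@colouring_comp A r))).
rewrite -big_mkcond /= => e; rewrite (_ : \sum_(x | _) _ = 0) ?mulr0z //.
rewrite /c exchange_big /= -[RHS]e; apply: eq_bigr => k _.
have pick (y : X) : \sum_(x | fingraph.root (adj_in A) x == r) ((x == y)%:R : int)
    = (y \in comp_of A r)%:R.
  rewrite (eq_bigl (mem (comp_of A r))) //; have [hy|hy] := boolP (y \in _).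
    rewrite (bigD1 y) //= eqxx big1 ?addr0 // => x /andP[_ /negbTE ->] //.
  rewrite big1 // => x hx; case: eqP => // exy.
  by move: hx; rewrite /= exy (negbTE hy).
by rewrite sumrB !pick.
Qed.

End Homogeneous.

Lemma exists_part (s : seq (X * X * seq X)) :
  \sum_(k <- s) lnc G k != 0 ->
  exists d, \sum_(k <- s | mono (word k) == d) lnc G k != 0.
Proof.
move: {2}(size s) (leqnn (size s)) => n.
elim: n s => [|n IH] [|k s] //=; rewrite ?big_nil ?eqxx // ltnS => hn hnz.
pose d := mono (word k).
case: (eqVneq (\sum_(l <- k :: s | mono (word l) == d) lnc G l) 0) => [e|]; last by exists d.
move: hnz; rewrite (bigID (fun l => mono (word l) == d)) e /= add0r.
rewrite -big_filter /= eqxx /= => hnz.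
have [|d' hd'] := IH _ _ hnz.
  by rewrite size_filter (leq_trans (count_size _ _)).
exists d'; move: hd'; rewrite big_filter_cond big_cons.
have [->|nd] := eqVneq d' d.
  by rewrite big_pred0 ?eqxx // => l; rewrite andNb.
congr (_ != 0); apply: eq_bigl => l.
by rewrite andbC; case: eqP => // ->.
Qed.

(** The multiplicities of a homogeneous element add up to zero over the components,
    so that they cannot all vanish away from the component of [a0].  The freedom
    in the choice of [a0] is used to find two detecting components, and to find
    one that avoids an endpoint. *)
Lemma crep_detect u : (forall x, lin x u = 0) -> u != 0 ->
  exists A : {set X}, forall a0, exists2 x0, x0 \in A &
    ~~ connect (adj_in A) a0 x0 /\ (crep var A (comp_of A x0) u).2 != 0.
Proof.
move=> /lin0_span [s ->] /exists_part [d hd]; exists (msupport d) => a0.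
apply: contrapT => hno; case/eqP: hd; apply: (@part_eq0 s d a0) => x0 hx0 hc.
by apply/eqP/negPn/negP => hnz; apply: hno; exists x0.
Qed.

Lemma crep_fst_coef A C z x : colouring A C ->
  (crep var A C z).1@_U_(enum_rank x) = if x \in A then lin x z else 0.
Proof.
move=> h; rewrite /crep wrep_fst; last exact: colouring_compat.
rewrite raddf_sum (bigD1 x) //= big1 ?addr0 => [|y nyx].
  rewrite /colt mulrzr raddfMz /=; case: ifP => _; last by rewrite mcoeff0 mul0rz.
  by rewrite /var mcoeffXU eqxx -[1%:R]/(1 : int) intz.
rewrite /colt mulrzr raddfMz /=; case: ifP => _; last by rewrite mcoeff0 mul0rz.
by rewrite /var mcoeffXU (inj_eq enum_rank_inj) (negbTE nyx) mul0rz.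
Qed.

(** Setting the variable of [y] to zero removes [y] from the coloured set. *)
Lemma crep_setU1_neq0 A C y u : colouring (y |: A) C -> y \notin A ->
  ((crep var A C u).1 != 0 -> (crep var (y |: A) C u).1 != 0) /\
  ((crep var A C u).2 != 0 -> (crep var (y |: A) C u).2 != 0).
Proof.
move=> h hy.
pose f := comp_mpoly [tuple (if enum_val i == y then 0 else 'X_i : {mpoly int[#|X|]}) | i < #|X|].
have fvar x : f (var x) = if x == y then 0 else var x.
  by rewrite /f /var comp_mpolyXU -tnth_nth tnth_mktuple enum_rankK.
have ft x : colt var A x = f (colt var (y |: A) x).
  rewrite /colt in_setU1; case: (eqVneq x y) => [->|nxy] /=.
    by rewrite (negbTE hy) fvar eqxx.
  by case: ifP => _; rewrite ?fvar ?(negbTE nxy) // /f raddf0.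
have -> : crep var A C u = wreath_map f (crep var (y |: A) C u).
  rewrite /crep -wrep_map; last exact: colouring_compat.
  apply: wrep_ext => x /=; first exact: ft.
  by rewrite /colw; case: ifP => _; rewrite ?ft // /f raddf0.
by split=> /=; apply: contraNneq => ->; rewrite /f raddf0.
Qed.

End Colourings.

Arguments var {X} x.

(** * Centralisers in the derived ideal over an acyclic graph *)

Definition acyclic (X : finType) (G : sgraph X) : Prop :=
  forall c : seq X, (2 < size c)%N -> ~ ucycle (adj G) c.

Section Acyclic.
Variables (X : finType) (G : sgraph X).
Local Notation M := (pc_metab G).
Hypothesis hG : acyclic G.

(** A path that avoids [c] would be closed to a cycle by [c]. *)
Lemma acyclic_separates c y1 y2 : adj G c y1 -> adj G c y2 -> y1 != y2 ->
  ~~ connect (adj_in G [set~ c]) y1 y2.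
Proof.
move=> h1 h2 ne; apply/negP => /connectP [p0 hp0 e].
case/shortenP: hp0 e ne => p hp hu _ e ne {p0}.
apply: (hG (c := c :: y1 :: p)); first by case: p e {hp hu} => //= e; rewrite e eqxx in ne.
have pathG q z : path (adj_in G [set~ c]) z q -> path (adj G) z q /\ c \notin q.
  elim: q z => //= z' q IH z /andP[/and3P[_ h3 h4] /IH [h5 h6]].
  by rewrite h4 inE negb_or h5 h6; split=> //; move: h3; rewrite !inE eq_sym => ->.
have [hp1 hp2] := pathG _ _ hp.
rewrite /ucycle [uniq _]cons_uniq hu andbT inE negb_or hp2 andbT.
rewrite /= rcons_path h1 hp1 -e adj_sym h2 /=.
by apply: contraTneq h1 => ->; rewrite adj_irr.
Qed.

Lemma connect_adj_inS (A B : {set X}) x y : A \subset B ->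
  connect (adj_in G A) x y -> connect (adj_in G B) x y.
Proof.
move=> /subsetP hAB; apply: connect_sub => {}x {}y /and3P[hx hy hxy].
by apply: connect1; rewrite /adj_in !hAB.
Qed.

Lemma comp_connect (A : {set X}) x z : z \in comp_of G A x ->
  connect (adj_in G (comp_of G A x)) x z.
Proof.
rewrite inE => /connectP [p hp ->]; elim/last_ind: p hp => [|p y IH] /=.
  by rewrite connect0.
rewrite rcons_path last_rcons => /andP[hp hy].
have hc : connect (adj_in G A) x (last x p) by apply/connectP; exists p.
apply: connect_trans (IH hp) _; apply: connect1; rewrite /adj_in !inE hc.
rewrite (connect_trans hc (connect1 hy)) /=.
by case/and3P: hy.
Qed.

(** The bracket is sent to the product of two elements of a domain, one non-zero,
    the other the linear form of [z] restricted to [A]. *)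
Lemma lie_eq0_lin (A C : {set X}) (u z : M) l : (forall x, lin x u = 0) ->
  lie u z = 0 -> colouring G A C -> (crep var A C u).2 != 0 -> l \in A ->
  lin l z = 0.
Proof.
move=> hu huz hC hnz hl.
have hc := colouring_compat var hC.
have : (crep var A C (lie u z)).2 = 0.
  by rewrite huz /crep (lie_morph0 (wrep_morph hc)).
rewrite /crep (lie_morphL (wrep_morph hc)) wreath_lieE /= -/(crep var A C).
have -> : (crep var A C u).1 = 0.
  by rewrite /crep wrep_fst // big1 // => x _; rewrite hu mulr0.
rewrite mulr0 subr0 => /eqP; rewrite mulf_eq0 (negbTE hnz) /= => /eqP h.
by have := crep_fst_coef z l hC; rewrite hl h mcoeff0.
Qed.

(** If [l] occurs in the linear part of an element that kills [u], then [l] must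
    touch each of the components that detect [u]: otherwise [l] could be added
    to the coloured set. *)
Lemma lie_eq0_touch (A : {set X}) x0 (u z : M) l : (forall x, lin x u = 0) ->
  lie u z = 0 -> lin l z != 0 -> (crep var A (comp_of G A x0) u).2 != 0 ->
  x0 \in A -> l \notin A /\ exists2 b, adj G l b & connect (adj_in G A) x0 b.
Proof.
move=> hu huz hl hnz x0A.
have lA : l \notin A.
  apply: contraNN hl => lA.
  by rewrite (lie_eq0_lin hu huz (@colouring_comp _ G A x0) hnz lA).
split=> //; apply: contrapT => hno.
have sub x : x \in comp_of G A x0 -> x \in A.
  by rewrite inE => /connect_adj_in_mem <-.
have lC : l \notin comp_of G A x0 by apply: contraNN lA; exact: sub.
have nb x : adj G l x -> x \notin comp_of G A x0.
  by move=> hx; rewrite inE; apply/negP => hc; apply: hno; exists x.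
have hcol : colouring G (l |: A) (comp_of G A x0).
  move=> x y; rewrite !in_setU1 => /predU1P[->|hx] /predU1P[->|hy].
  - by [].
  - by move=> hxy; rewrite (negbTE lC) (negbTE (nb _ hxy)).
  - by rewrite adj_sym => hxy; rewrite (negbTE lC) (negbTE (nb _ hxy)).
  - exact: colouring_comp.
have hnz' := (crep_setU1_neq0 u hcol lA).2 hnz.
by case/eqP: hl; apply: (lie_eq0_lin hu huz hcol hnz'); rewrite setU11.
Qed.

(** Two components detect [u], and both are touched by every vertex in the linear
    part of [z]; two such vertices would close a cycle. *)
Lemma lie_eq0_vertex (u z : M) l : (forall x, lin x u = 0) -> u != 0 ->
  lie u z = 0 -> lin l z != 0 ->
  (1 < degree G l)%N /\ forall l', lin l' z != 0 -> l' = l.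
Proof.
move=> hu hnz huz hl; have [A hA] := crep_detect hu hnz.
have [x0 x0A [_ hnz0]] := hA l; have [x1 x1A [hx01 hnz1]] := hA x0.
have touch l' (hl' : lin l' z != 0) :
    [/\ l' \notin A, exists2 b, adj G l' b & connect (adj_in G A) x0 b
      & exists2 b, adj G l' b & connect (adj_in G A) x1 b].
  have [h h0] := lie_eq0_touch hu huz hl' hnz0 x0A.
  by have [_ h1] := lie_eq0_touch hu huz hl' hnz1 x1A.
have csym := @connect_adj_in_sym _ G.
have sep b0 b1 : connect (adj_in G A) x0 b0 -> connect (adj_in G A) x1 b1 ->
    b0 != b1.
  move=> h0 h1; apply: contraNneq hx01 => e.
  by rewrite (connect_trans h0) // e csym.
have [lA [b0 lb0 c0] [b1 lb1 c1]] := touch l hl.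
split.
  rewrite /degree (cardsD1 b0) inE lb0 (cardsD1 b1) !inE lb1.
  by rewrite eq_sym (sep _ _ c0 c1).
move=> l' hl'; have [//|nll] := eqVneq l' l.
have [l'A [b0' lb0' c0'] [b1' lb1' c1']] := touch l' hl'.
have := acyclic_separates lb0 lb1 (sep _ _ c0 c1).
have sA : A \subset [set~ l].
  by apply/subsetP => x hx; rewrite !inE; apply: contraTneq hx => ->.
have in_l b : connect (adj_in G A) x0 b \/ connect (adj_in G A) x1 b ->
    b \in [set~ l].
  by case=> h; apply: (subsetP sA); rewrite -(connect_adj_in_mem h).
have step b : connect (adj_in G A) x0 b \/ connect (adj_in G A) x1 b ->
    adj G l' b -> adj_in G [set~ l] b l'.
  move=> h hb; rewrite /adj_in in_l //= adj_sym hb andbT.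
  by rewrite !inE.
case/negP; apply: (connect_trans (y := b0')).
  apply: connect_adj_inS sA _; apply: connect_trans c0'.
  by rewrite csym.
apply: (connect_trans (y := l')); first by apply: connect1; apply: step; [left|].
apply: (connect_trans (y := b1')).
  by rewrite csym; apply: connect1; apply: step; [right|].
apply: connect_adj_inS sA _; apply: connect_trans c1.
by rewrite csym.
Qed.

End Acyclic.

(** * Absorbing an endpoint *)

Lemma nat_nonroot (K : idomainType) (p : {poly K}) :
  (forall n, n.+1%:R != 0 :> K) -> p != 0 -> exists n : nat, p.[n%:R] != 0.
Proof.
move=> hK hp; apply: contrapT => hno.
have inj : injective (fun n : nat => n%:R : K).
  have lt_neq m n : (m < n)%N -> m%:R != n%:R :> K.
    move=> hmn; rewrite eq_sym -subr_eq0 -natrB ?(ltnW hmn) //.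
    by rewrite -(subnSK hmn) hK.
  move=> m n e; case: (ltngtP m n) => // /lt_neq; first by rewrite e eqxx.
  by rewrite e eqxx.
have hall : all (root p) [seq n%:R | n <- iota 0 (size p)].
  by apply/allP => _ /mapP [n _ ->]; apply/negPn/negP => h; apply: hno; exists n.
have hu : uniq [seq n%:R : K | n <- iota 0 (size p)].
  by rewrite map_inj_uniq ?iota_uniq.
by have := max_poly_roots hp hall hu; rewrite size_map size_iota ltnn.
Qed.

Lemma nat_nonroot2 (K : idomainType) (p : {poly {poly K}}) :
  (forall n, n.+1%:R != 0 :> K) -> p != 0 ->
  exists m n : nat, p.[n%:R].[m%:R] != 0.
Proof.
move=> hK hp; have [|n hn] := nat_nonroot _ hp.
  by move=> n; rewrite -polyC_natr polyC_eq0.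
by have [m hm] := nat_nonroot hK hn; exists m, n.
Qed.

(** The endpoint [l] at [c] is replaced by a combination of two neighbours of [c],
    which commutes with [c] as [l] does. *)
Section Absorb.
Variables (X : finType) (G : sgraph X).
Local Notation M := (pc_metab G).
Hypothesis hG : acyclic G.
Variables (l c y1 y2 : X).
Hypotheses (lc1 : adj G l c) (lc : forall x, adj G l x -> x = c)
  (cy1 : adj G c y1) (cy2 : adj G c y2)
  (ny : y1 != y2).

Let ncl : c != l.
Proof.
by apply: contraTneq lc1 => ->; rewrite adj_irr.
Qed.

Definition absorb_val (n1 n2 : nat) (x : X) : M :=
  if x == l then pc_gen G y1 *+ n1 + pc_gen G y2 *+ n2 else pc_gen G x.

Definition absorb (n1 n2 : nat) : M -> M := pc_lift (absorb_val n1 n2).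

Lemma absorb_val_comm n1 n2 x y :
  adj G x y -> lie (absorb_val n1 n2 x) (absorb_val n1 n2 y) = 0.
Proof.
have h z : adj G l z -> lie (absorb_val n1 n2 l) (absorb_val n1 n2 z) = 0.
  move=> /lc ->; rewrite /absorb_val eqxx (negbTE ncl) lieDl !lieMnl.
  rewrite [lie (pc_gen G y1) _]lieC [lie (pc_gen G y2) _]lieC.
  by rewrite (pc_gen_comm cy1) (pc_gen_comm cy2) oppr0 !mul0rn addr0.
have [->|nx] := eqVneq x l; first exact: h.
have [->|nyl] := eqVneq y l.
  by rewrite adj_sym => /h e; rewrite lieC e oppr0.
by move=> hxy; rewrite /absorb_val (negbTE nx) (negbTE nyl) pc_gen_comm.
Qed.

Lemma absorb_morph n1 n2 : lie_morph (absorb n1 n2).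
Proof. exact: pc_lift_morph (@pc_metabelian _ G) (@absorb_val_comm n1 n2). Qed.

Lemma absorb_gen n1 n2 x : absorb n1 n2 (pc_gen G x) = absorb_val n1 n2 x.
Proof. exact: pc_lift_gen (@pc_metabelian _ G) (@absorb_val_comm n1 n2) x. Qed.

Definition wnz (R : comNzRingType) (a : wreath R) : bool := (a.1 != 0) || (a.2 != 0).

(** An element with a linear part is detected with all vertices on one axis.  For
    the others, the component that detects [u] is chosen away from [l].  If [l] is in the
    coloured set, this component is connected in the complement of [c], hence
    touches at most one of [y1] and [y2]; the other can be coloured like [l]. *)
Lemma absorb_colouring (u : M) : u != 0 -> exists A C : {set X},
  [/\ colouring G A C, wnz (crep var A C u) &
    l \in A -> exists2 y, y \in A /\ (y = y1 \/ y = y2) & l \notin C /\ y \notin C].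
Proof.
move=> hu; have [[x hx]|hlin] := pselect (exists x, lin x u != 0).
  have hC : colouring G [set: X] set0 by move=> a b; rewrite !inE.
  exists [set: X], set0; split=> //; last by move=> _; exists y1; rewrite !inE //; split=> //; left.
  have := crep_fst_coef u x hC; rewrite inE /wnz => e.
  by apply/orP; left; apply: contraNneq hx => h; rewrite -e h mcoeff0.
have {}hlin x : lin x u = 0.
  by apply/eqP/negPn/negP => h; apply: hlin; exists x.
have [A hA] := crep_detect hlin hu; have [x0 x0A [hl hnz]] := hA l.
pose C := comp_of G A x0; have hC : colouring G A C := @colouring_comp _ G A x0.
have [lA|lA] := boolP (l \in A); last first.
  by exists A, C; split=> //; [rewrite /wnz hnz orbT | move=> h; rewrite h in lA].
have csym := @connect_adj_in_sym _ G.
have CA x : x \in C -> x \in A by rewrite inE => /connect_adj_in_mem <-.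
have lC : l \notin C by rewrite inE csym.
have cC : c \notin C.
  apply: contraNN lC => h; rewrite inE in h; rewrite inE.
  apply: connect_trans (h) _; apply: connect1; rewrite /adj_in lA adj_sym lc1.
  by rewrite /= andbT; apply: CA; rewrite inE.
have touch y : (forall b, b \in C -> ~~ adj G y b) -> y \notin C ->
    (y = y1 \/ y = y2) -> exists A C : {set X},
  [/\ colouring G A C, wnz (crep var A C u) &
    l \in A -> exists2 y, y \in A /\ (y = y1 \/ y = y2) & l \notin C /\ y \notin C].
  move=> hb yC hy12; exists (y |: A), C; have [yA|yA] := boolP (y \in A).
    rewrite (setUidPr _) ?sub1set //; split=> //; first by rewrite /wnz hnz orbT.
    by move=> _; exists y.
  have hC' : colouring G (y |: A) C.
    move=> a b; rewrite !in_setU1 => /predU1P[->|ha] /predU1P[->|hb'].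
    - by [].
    - move=> hab; rewrite (negbTE yC); apply/esym/negbTE.
      by apply: contraTN hab; exact: hb.
    - rewrite adj_sym => hab; rewrite (negbTE yC); apply/negbTE.
      by apply: contraTN hab; exact: hb.
    - exact: hC.
  split=> //; first by rewrite /wnz (crep_setU1_neq0 u hC' yA).2 ?orbT.
  by move=> _; exists y => //; rewrite setU11.
have conn y : adj G c y ->
    ~ ((forall b, b \in C -> ~~ adj G y b) /\ y \notin C) ->
    connect (adj_in G [set~ c]) x0 y.
  move=> hcy h; have sA : C \subset [set~ c].
    by apply/subsetP => z hz; rewrite !inE; apply: contraTneq hz => ->.
  have C_conn z : z \in C -> connect (adj_in G [set~ c]) x0 z.
    by move=> /comp_connect; exact: connect_adj_inS.
  have [yC|yC] := boolP (y \in C); first exact: C_conn.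
  have [b bC hb] : exists2 b, b \in C & adj G y b.
    apply: contrapT => hno; apply: h; split=> // b hb; apply/negP => hyb.
    by apply: hno; exists b.
  apply: connect_trans (C_conn b bC) _; apply: connect1.
  rewrite /adj_in (subsetP sA) //= adj_sym hb andbT !inE.
  by apply: contraTneq hcy => ->; rewrite adj_irr.
have [[h1 h2]|h1] := pselect ((forall b, b \in C -> ~~ adj G y1 b) /\ y1 \notin C).
  by apply: (touch y1) => //; left.
have [[h2 h3]|h2] := pselect ((forall b, b \in C -> ~~ adj G y2 b) /\ y2 \notin C).
  by apply: (touch y2) => //; right.
case/negP: (acyclic_separates hG cy1 cy2 ny).
apply: connect_trans (conn y2 cy2 h2).
by rewrite csym; exact: conn.
Qed.

Section Generic.
Variable K : fieldType.

(** The values at the generators of the representation obtained from [(t, w)] by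
    [absorb], with the two multiplicities replaced by the variables of a
    polynomial ring. *)
Definition gen_val (f : X -> K) (x : X) : {poly {poly K}} :=
  if x == l then ((f y1)%:P * 'X)%:P + (f y2)%:P%:P * 'X else (f x)%:P%:P.

Definition ev (m1 m2 : K) : {poly {poly K}} -> K :=
  horner_eval m1 \o horner_eval m2%:P.

HB.instance Definition _ m1 m2 := GRing.RMorphism.on (ev m1 m2).

Lemma ev_gen_val m1 m2 f x : ev m1 m2 (gen_val f x) =
  if x == l then f y1 * m1 + f y2 * m2 else f x.
Proof.
by rewrite /ev /gen_val /horner_eval /=; case: ifP => _; rewrite !hornerE.
Qed.

Lemma gen_val_compat t w : compat G t w -> compat G (gen_val t) (gen_val w).
Proof.
move=> h.
have hl z : adj G l z -> gen_val w l * gen_val t z = gen_val w z * gen_val t l.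
  move=> /lc ->; rewrite /gen_val eqxx (negbTE ncl).
  rewrite mulrDl mulrDr; congr (_ + _).
    rewrite -!polyCM mulrAC mulrA -!polyCM; congr (_%:P * _)%:P.
    by rewrite -(h _ _ cy1) mulrC.
  rewrite mulrAC mulrA -!polyCM; congr (_%:P%:P * _).
  by rewrite -(h _ _ cy2) mulrC.
move=> x y hxy.
have [ex|nx] := eqVneq x l; first by rewrite ex; apply: hl; rewrite -ex.
have [ey|ny'] := eqVneq y l; first by rewrite ey -hl // -ey adj_sym.
by rewrite /gen_val (negbTE nx) (negbTE ny') -!polyCM h.
Qed.

Lemma absorb_gen_val t w n1 n2 u : compat G t w ->
  wrep t w (absorb n1 n2 u) =
  wreath_map (ev n1%:R n2%:R) (wrep (gen_val t) (gen_val w) u).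
Proof.
move=> h; have h' := gen_val_compat h.
apply: (pc_morph_ext (lie_morph_comp (wrep_morph h) (absorb_morph n1 n2))
  (lie_morph_comp (wreath_map_morph (ev _ _)) (wrep_morph h'))) => x /=.
rewrite absorb_gen wrep_gen // /wreath_map /= !ev_gen_val /absorb_val.
case: ifP => _; last by rewrite wrep_gen.
rewrite (lie_morphD (wrep_morph h)) !(lie_morphMn (wrep_morph h)) !wrep_gen //.
rewrite !wreath_Mn !mulr_natr.
by [].
Qed.

(** The generic representation specialises at [(m1, m2)] to the given one, which
    detects [u]; so one of its two components at [u] is a non-zero polynomial, and
    [absorb] is its specialisation at integers. *)
Lemma absorb_generic (t w : X -> K) m1 m2 (u : M) : compat G t w ->
  t l = t y1 * m1 + t y2 * m2 -> w l = w y1 * m1 + w y2 * m2 ->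
  wnz (wrep t w u) ->
  exists2 g : {poly {poly K}}, g != 0 &
    forall n1 n2 : nat, g.[n2%:R].[n1%:R] != 0 -> absorb n1 n2 u != 0.
Proof.
move=> h ht hw hnz; have h' := gen_val_compat h.
have evE f : f l = f y1 * m1 + f y2 * m2 -> f =1 ev m1 m2 \o gen_val f.
  by move=> hf x /=; rewrite ev_gen_val; case: eqP => // ->.
rewrite (wrep_ext _ (evE t ht) (evE w hw)) (wrep_map (ev m1 m2) u h') in hnz.
set z := wrep (gen_val t) (gen_val w) u in hnz.
have evz n1 n2 : absorb n1 n2 u = 0 ->
    z.1.[n2%:R].[n1%:R] = 0 /\ z.2.[n2%:R].[n1%:R] = 0.
  move=> e; have := absorb_gen_val n1 n2 u h.
  rewrite e (lie_morph0 (wrep_morph h)) /wreath_map -/z /= /ev /horner_eval /=.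
  by rewrite !polyC_natr => -[-> ->].
case/orP: hnz => /= hnz.
- exists z.1; first by apply: contraNneq hnz => ->; rewrite raddf0.
  by move=> n1 n2; apply: contraNneq => /evz [-> _].
- exists z.2; first by apply: contraNneq hnz => ->; rewrite raddf0.
  by move=> n1 n2; apply: contraNneq => /evz [_ ->].
Qed.

Lemma absorb_family (s : seq M) : (forall n, n.+1%:R != 0 :> K) ->
  (forall u, u \in s -> exists2 g : {poly {poly K}}, g != 0 &
    forall n1 n2 : nat, g.[n2%:R].[n1%:R] != 0 -> absorb n1 n2 u != 0) ->
  exists n1 n2 : nat, forall u, u \in s -> absorb n1 n2 u != 0.
Proof.
move=> hK hs.
suff [g hg hgs] : exists2 g : {poly {poly K}}, g != 0 & forall n1 n2 : nat,
    g.[n2%:R].[n1%:R] != 0 -> forall u, u \in s -> absorb n1 n2 u != 0.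
  by have [n1 [n2 /hgs h]] := nat_nonroot2 hK hg; exists n1, n2.
elim: s hs => [|u s IH] hs; first by exists 1; rewrite ?oner_eq0.
have [g hg hgs] := IH (fun v hv => hs v (mem_behead (s := u :: s) hv)).
have [f hf hfu] := hs u (mem_head _ _).
exists (f * g); first by rewrite mulf_neq0.
move=> n1 n2; rewrite !hornerM mulf_eq0 negb_or => /andP[h1 h2] v.
by rewrite inE => /predU1P[->|hv]; [exact: hfu | exact: hgs].
Qed.

End Generic.

Lemma absorb_avoids (s : seq M) : (forall u, u \in s -> u != 0) ->
  exists n1 n2 : nat, forall u, u \in s -> absorb n1 n2 u != 0.
Proof.
move=> hs; pose K := {fraction {mpoly int[#|X|]}}.
pose inj : {rmorphism {mpoly int[#|X|]} -> K} := @tofrac _.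
have inj0 p : (inj p == 0) = (p == 0) by exact: tofrac_eq0.
apply: (@absorb_family K) => [n|u /hs hu].
  rewrite -(rmorph_nat inj) inj0 -mpolyC_nat mpolyC_eq0.
  by rewrite Num.Theory.pnatr_eq0.
have [A [C [hC hnz hl]]] := absorb_colouring hu.
have hc := colouring_compat var hC.
pose t := inj \o colt var A; pose w := inj \o colw var A C.
have hcK : compat G t w by move=> x y hxy; rewrite /t /w /= -!rmorphM hc.
have hnzK : wnz (wrep t w u).
  rewrite /t /w (wrep_map inj u hc) /wnz /= !inj0.
  exact: hnz.
have [lA|lA] := boolP (l \in A); last first.
  apply: (absorb_generic (m1 := 0) (m2 := 0) hcK _ _ hnzK).
    by rewrite /t /= /colt (negbTE lA) rmorph0 !mulr0 addr0.
  by rewrite /w /= /colw /colt (negbTE lA) if_same rmorph0 !mulr0 addr0.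
have [y [yA hy] [lC yC]] := hl lA.
have var_y : inj (var y) != 0.
  rewrite inj0; apply/eqP => /(congr1 (mcoeff U_(enum_rank y))).
  by rewrite mcoeffXU eqxx mcoeff0.
(* [l] and [y] are on the same axis, hence proportional over the fraction field. *)
pose m := inj (var l) / inj (var y).
have ht : t l = t y * m by rewrite /t /= /colt lA yA mulrC divfK.
have hw : w l = w y * m.
  by rewrite /w /= /colw (negbTE lC) (negbTE yC) rmorph0 mul0r.
case: hy => ey; rewrite ey in ht hw.
- by apply: (absorb_generic (m1 := m) (m2 := 0) hcK _ _ hnzK); rewrite mulr0 addr0.
- by apply: (absorb_generic (m1 := 0) (m2 := m) hcK _ _ hnzK); rewrite mulr0 add0r.
Qed.

End Absorb.

(** * Discrimination by way of a core *)

Section Core.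
Variables (X : finType) (G : sgraph X).
Local Notation M := (pc_metab G).
Hypothesis hG : acyclic G.
(** The vertices outside the core [K] are endpoints that can be absorbed into it. *)
Variable K : {set X}.
Hypothesis hK : forall l, l \notin K -> exists c y1 y2,
  [/\ adj G l c, forall x, adj G l x -> x = c, adj G c y1 /\ adj G c y2,
      y1 != y2 & y1 \in K /\ y2 \in K].

(** The endpoints are absorbed one at a time.  The retraction [r] serves to say that
    the images end up in the subring generated by the core. *)
Lemma core_absorb (r : M -> M) (L : seq X) (s : seq M) :
  lie_morph r -> (forall x, x \in K -> r (pc_gen G x) = pc_gen G x) ->
  {in L, forall l, l \notin K} -> (forall u, u \in s -> u != 0) ->
  exists f : M -> M, [/\ lie_morph f, forall u, u \in s -> f u != 0,
    forall x, x \in K -> f (pc_gen G x) = pc_gen G x &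
    forall x, x \in L -> r (f (pc_gen G x)) = f (pc_gen G x)].
Proof.
move=> hr hrK; elim: L s => [|l L IH] s hL hs.
  by exists id; split.
have lK : l \notin K by apply: hL; exact: mem_head.
have [c [y1 [y2 [lc1 lc [cy1 cy2] ny [y1K y2K]]]]] := hK lK.
have nl y : y \in K -> y != l by move=> yK; apply: contraNneq lK => <-.
have [n1 [n2 hn]] :=
  absorb_avoids hG lc1 lc cy1 cy2 ny hs.
pose a := @absorb _ G l y1 y2 n1 n2.
have ha : lie_morph a := absorb_morph lc1 lc cy1 cy2 n1 n2.
have aE x : a (pc_gen G x) = absorb_val G l y1 y2 n1 n2 x :=
  absorb_gen lc1 lc cy1 cy2 n1 n2 x.
have [||f [hf fs fK fL]] := IH [seq a u | u <- s].
- by move=> x hx; apply: hL; rewrite inE hx orbT.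
- by move=> _ /mapP [u hu ->]; exact: hn.
exists (f \o a); split=> [|u hu|x xK|x]; first exact: lie_morph_comp.
- by apply: fs; apply/mapP; exists u.
- by rewrite /= aE /absorb_val (negbTE (nl _ xK)) fK.
rewrite /= aE /absorb_val; case: eqP => [_ _|/eqP nx].
  rewrite (lie_morphD hf) !(lie_morphMn hf) (lie_morphD hr).
  by rewrite !(lie_morphMn hr) !fK // !hrK.
by rewrite inE (negbTE nx) /=; exact: fL.
Qed.

Variables (Y : finType) (H : sgraph Y) (g : X -> Y).
Hypothesis g_inj : {in K &, injective g}.
Hypothesis g_mono : {in K &, {mono g : x y / adj G x y >-> adj H x y}}.

(** The map [p] kills the vertices outside the core, and has a left inverse [q] on
    the subring generated by the core; all generators are first absorbed into that
    subring. *)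
Lemma core_discriminates : discriminates M (pc_metab H).
Proof.
move=> s hs.
pose vp x := if x \in K then pc_gen H (g x) else 0.
pose p : M -> pc_metab H := pc_lift vp.
have vpC x y : adj G x y -> lie (vp x) (vp y) = 0.
  rewrite /vp => hxy; case: ifP => hx; last by rewrite lie0l.
  by case: ifP => hy; rewrite ?lier0 // pc_gen_comm // g_mono.
have hp : lie_morph p := pc_lift_morph (@pc_metabelian _ H) vpC.
pose vq y := if [pick x in K | g x == y] is Some x then pc_gen G x else 0.
pose q : pc_metab H -> M := pc_lift vq.
have vqC x y : adj H x y -> lie (vq x) (vq y) = 0.
  rewrite /vq; case: pickP => [a /andP[ha /eqP <-]|_]; last by rewrite lie0l.
  case: pickP => [b /andP[hb /eqP <-]|_]; last by rewrite lier0.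
  by rewrite g_mono //; exact: pc_gen_comm.
have hq : lie_morph q := pc_lift_morph (@pc_metabelian _ G) vqC.
have qpK x : x \in K -> q (p (pc_gen G x)) = pc_gen G x.
  move=> hx; rewrite /p (pc_lift_gen (@pc_metabelian _ H) vpC) /vp hx.
  rewrite /q (pc_lift_gen (@pc_metabelian _ G) vqC) /vq.
  case: pickP => [a /andP[ha /eqP /g_inj -> //]|/(_ x)].
  by rewrite hx eqxx.
have [|f [hf fs fK fL]] :=
  core_absorb (L := enum (~: K)) (lie_morph_comp hq hp) qpK _ hs.
  by move=> x; rewrite mem_enum inE.
exists (p \o f) => [|u hu]; first exact: lie_morph_comp.
suff /(_ u) e : (q \o p) \o f =1 f.
  apply: contraNneq (fs u hu) => /= e0; rewrite -e /= e0.
  by rewrite (lie_morph0 hq).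
apply: pc_morph_ext => //; first by do 2!apply: lie_morph_comp => //.
move=> x; have [xK|xK] := boolP (x \in K); first by rewrite /= fK ?qpK.
by apply: fL; rewrite mem_enum inE.
Qed.

End Core.

(** * Non-vanishing and torsion *)

Section NonVanishing.
Variables (X : finType) (G : sgraph X).
Local Notation M := (pc_metab G).

Lemma wrep_snd0 (R : comNzRingType) (w : X -> R) (z : M) :
  (wrep (fun=> 0) w z).2 = \sum_x w x * (lin x z)%:~R.
Proof.
have h : compat G (fun=> 0) w by move=> x y _; rewrite !mulr0.
elim/pc_ind: z => [y||a b ha hb|a ha|a b _ _].
- rewrite wrep_gen // (bigD1 y) //= lin_gen eqxx mulr1 big1 ?addr0 // => x.
  by rewrite lin_gen eq_sym => /negbTE ->; rewrite mulr0.
- rewrite (lie_morph0 (wrep_morph h)) big1 // => x _.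
  by rewrite lin0 mulr0.
- rewrite (lie_morphD (wrep_morph h)) /= ha hb -big_split /=.
  by apply: eq_bigr => x _; rewrite linD rmorphD mulrDr.
- rewrite (lie_morphN (wrep_morph h)) /= ha -sumrN.
  by apply: eq_bigr => x _; rewrite linN rmorphN mulrN.
- rewrite (lie_morphL (wrep_morph h)) wreath_lieE /= !wrep_fst //.
  by rewrite !big1 ?mulr0 ?subr0 // => x _; rewrite ?lin_lie ?mulr0 ?mul0r.
Qed.

(** If [y] and [y'] are not adjacent, the representation that sends [y] to [(0, 1)],
    [y'] to [('X, 0)] and the other vertices to zero shows the part of degree two of
    the bracket: the second component of the image of [z] is [lin y z] modulo ['X]. *)
Lemma adj_of_comm (z z' : M) y y' : lie z z' = 0 ->
  lin y z != 0 -> lin y' z = 0 -> lin y' z' != 0 -> adj G y y'.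
Proof.
move=> hzz hy hy0 hy'; apply/negPn/negP => nadj.
pose t x : {poly int} := (x == y')%:R * 'X.
pose w x : {poly int} := (x == y)%:R.
have h : compat G t w.
  suff h0 a b : adj G a b -> w a * t b = 0.
    by move=> a b hab; rewrite !h0 // adj_sym.
  move=> hab; rewrite /w /t; case: eqP => [ea|]; last by rewrite mul0r.
  case: eqP => [eb|]; last by rewrite mul0r mulr0.
  by rewrite -ea -eb hab in nadj.
have tE (v : M) : (wrep t w v).1 = (lin y' v)%:~R * 'X.
  rewrite wrep_fst // (bigD1 y') //= /t eqxx mul1r big1 ?addr0 1?mulrC // => x.
  by move=> /negbTE ->; rewrite !mul0r.
have : (wrep t w (lie z z')).2 = 0 by rewrite hzz (lie_morph0 (wrep_morph h)).
rewrite (lie_morphL (wrep_morph h)) wreath_lieE /= !tE hy0 mul0r mulr0 subr0.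
move/eqP; rewrite !mulf_eq0 polyX_eq0 orbF -(rmorph_int (@polyC int)) polyC_eq0.
rewrite intz (negbTE hy') orbF => /eqP hw.
have : (wrep (G := G) (horner_eval 0 \o t) (horner_eval 0 \o w) z).2 = 0.
  by rewrite wrep_map // /wreath_map /= hw raddf0.
have -> : wrep (G := G) (horner_eval 0 \o t) (horner_eval 0 \o w) z
    = wrep (fun=> 0) (fun x => (x == y)%:R) z.
  apply: wrep_ext => x; rewrite /= /horner_eval /t /w ?hornerMX ?mulr0 //.
  by case: (x == y); rewrite !hornerE.
rewrite wrep_snd0 (bigD1 y) //= eqxx mul1r big1 ?addr0 => [|x /negbTE ->].
  by move/eqP; rewrite intz (negbTE hy).
by rewrite mul0r.
Qed.

(** The set of [p], [q], [j], with [q] as a component, is a colouring. *)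
Lemma bracket3_neq0 p q j : ~~ adj G p q -> p != q -> ~~ adj G j q -> j != q ->
  lie (lie (pc_gen G p) (pc_gen G q)) (pc_gen G j) != 0.
Proof.
move=> hpq npq hjq njq.
pose A := [set p; q; j]; pose C := [set q].
have hC : colouring G A C.
  have nb x : x \in A -> ~~ adj G q x.
    rewrite !inE -orbA => /or3P[] /eqP ->; rewrite ?adj_irr // adj_sym //.
  move=> x y hx hy hxy; rewrite !inE.
  have [ex|_] := eqVneq x q; first by move: hxy; rewrite ex (negbTE (nb _ hy)).
  by apply/esym/negbTE; apply: contraTneq hxy => ->; rewrite adj_sym nb.
have hc := colouring_compat (fun=> 1 : int) hC.
apply/eqP => /(congr1 (fun z => (crep (fun=> 1 : int) A C z).2)).
rewrite /crep (lie_morph0 (wrep_morph hc)) !(lie_morphL (wrep_morph hc)).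
rewrite !wreath_lieE !wrep_gen //= /colw /colt !inE !eqxx !orbT /=.
by rewrite (negbTE npq) (negbTE njq).
Qed.

Lemma lin0_torsionfree (u : M) n : (forall x, lin x u = 0) -> u *~ n = 0 ->
  u != 0 -> n = 0.
Proof.
move=> hu hun hnz; have [A hA] := crep_detect hu hnz.
have [x _] : exists x : X, True.
  apply: contrapT => hno; case/eqP: hnz.
  have [s ->] := lin0_span hu; case: s => [|k s]; first by rewrite big_nil.
  by case: hno; exists k.1.1.
have [x0 _ [_ hx0]] := hA x.
have hc := colouring_compat var (@colouring_comp _ G A x0).
have h := lie_morph0 (wrep_morph hc).
have : (crep var A (comp_of G A x0) (u *~ n)).2 = 0 by rewrite hun /crep h.
rewrite /crep (lie_morphMz (wrep_morph hc)) -/(crep _ _ _ _).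
have zsnd (a : wreath {mpoly int[#|X|]}) : (a *~ n).2 = a.2 *~ n.
  case: a => a b; case: n {hun} => n; first by rewrite -!pmulrn wreath_Mn.
  by rewrite !NegzE !mulrNz -!pmulrn wreath_Mn.
rewrite zsnd -mulrzr => /eqP; rewrite mulf_eq0 (negbTE hx0) /=.
by rewrite -(rmorph_int (@mpolyC _ int)) mpolyC_eq0 intz => /eqP.
Qed.

End NonVanishing.

(** * Trees *)

Section Connected.
Variables (X : finType) (G : sgraph X).
Hypothesis hcon : forall x y : X, connect (adj G) x y.
Hypothesis hX : (2 <= #|X|)%N.

Lemma endpoint_uniq x a b : endpoint G x -> adj G x a -> adj G x b -> a = b.
Proof.
move=> /cards1P [y hy] ha hb.
have : a \in [set y] by rewrite -hy inE.
have : b \in [set y] by rewrite -hy inE.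
by rewrite !inE => /eqP -> /eqP ->.
Qed.

Lemma exists_adj x : exists y, adj G x y.
Proof.
have [y hy] : exists y, y != x.
  apply: contrapT => hno; move: hX; rewrite (@eq_card1 _ x) // => y.
  by rewrite !inE; apply/esym/negPn/negP => h; apply: hno; exists y.
have /connectP [[|z p] /= hp e] := hcon x y; first by rewrite e eqxx in hy.
by exists z; case/andP: hp.
Qed.

Lemma degree_gt1 x : ~~ endpoint G x -> (1 < degree G x)%N.
Proof.
rewrite /endpoint => h; rewrite ltn_neqAle eq_sym h /= /degree.
by have [y hy] := exists_adj x; apply/card_gt0P; exists y; rewrite inE.
Qed.

Lemma degree_gt1P x :
  (1 < degree G x)%N -> exists p q, [/\ adj G x p, adj G x q & p != q].
Proof. by move=> /card_gt1P [p [q]]; rewrite !inE => -[]; exists p, q. Qed.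

Lemma adjacent_endpoints a b : adj G a b -> endpoint G a -> endpoint G b ->
  forall x, x = a \/ x = b.
Proof.
move=> hab ha hb x; have : closed (adj G) (mem [set a; b]).
  have nb y z : adj G y z -> y \in [set a; b] -> z \in [set a; b].
    move=> hyz; rewrite !inE => /orP[] /eqP ey; rewrite ey in hyz.
      by rewrite (endpoint_uniq ha hyz hab) eqxx orbT.
    by rewrite (endpoint_uniq hb hyz (b := a)) ?eqxx // adj_sym.
  by move=> y z hyz; apply/idP/idP; apply: nb => //; rewrite adj_sym.
move=> /closed_connect /(_ a x (hcon a x)) /=.
by rewrite !inE eqxx /= => /esym /orP[] /eqP ->; [left | right].
Qed.

Lemma all_endpoints : (forall x, endpoint G x) ->
  exists a b, [/\ adj G a b & forall x, x = a \/ x = b].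
Proof.
move=> h; have [a _] : exists a : X, a \in X by apply/card_gt0P; exact: ltnW.
have [b hab] := exists_adj a; exists a, b; split=> //.
exact: adjacent_endpoints.
Qed.

End Connected.

Lemma pc_abelian (X : finType) (G : sgraph X) :
  (forall x y, lie (pc_gen G x) (pc_gen G y) = 0) ->
  forall z z' : pc_metab G, lie z z' = 0.
Proof.
have abel (w : pc_metab G) : (forall x, lie (pc_gen G x) w = 0) ->
    forall z, lie z w = 0.
  move=> h z; elim/pc_ind: z => [x||a b ha hb|a ha|a b ha hb].
  - exact: h.
  - by rewrite lie0l.
  - by rewrite lieDl ha hb addr0.
  - by rewrite lieNl ha oppr0.
  - by rewrite lie_leibniz ha hb !lie0l subr0.
move=> h z z'; apply: (abel) => x; rewrite lieC.
by rewrite abel ?oppr0.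
Qed.

(** * Discrimination embeds the non-endpoints *)

Section StarEmbedding.
Variables (X Y : finType) (G : sgraph X) (H : sgraph Y).
Hypotheses (hG : is_tree G) (hH : is_tree H).
Hypotheses (hX : (2 <= #|X|)%N) (hY : (2 <= #|Y|)%N).
Hypothesis hd : discriminates (pc_metab G) (pc_metab H).

Let gconn := hG.1.
Let gacyc : acyclic G := hG.2.
Let hconn := hH.1.
Let hacyc : acyclic H := hH.2.

Let nbr1 i := nth i (enum [set y | adj G i y]) 0.
Let nbr2 i := nth i (enum [set y | adj G i y]) 1.

Let nbrP i : ~~ endpoint G i ->
  [/\ adj G i (nbr1 i), adj G i (nbr2 i) & nbr1 i != nbr2 i].
Proof.
move=> /(degree_gt1 gconn hX) h; rewrite /nbr1 /nbr2.
set s := enum _; have hs : (1 < size s)%N by rewrite -cardE.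
have mem k : (k < size s)%N -> adj G i (nth i s k).
  by move=> /(mem_nth i); rewrite mem_enum inE.
by rewrite !mem ?(ltnW hs) // nth_uniq ?enum_uniq // ltnW.
Qed.

Let nadj i p q : adj G i p -> adj G i q -> ~~ adj G p q.
Proof.
move=> hp hq; apply/negP => hpq.
have npq : p != q by apply: contraTneq hpq => ->; rewrite adj_irr.
case/negP: (acyclic_separates gacyc hp hq npq); apply: connect1.
rewrite /adj_in hpq !inE.
have n k : adj G i k -> k != i by move=> hk; apply: contraTneq hk => ->; rewrite adj_irr.
by rewrite !n.
Qed.

(* The vertex [i] is determined by [wedge i] as the only vertex that kills it. *)
Let wedge i := lie (pc_gen G (nbr1 i)) (pc_gen G (nbr2 i)).

Let wedge_kill i : ~~ endpoint G i -> lie (wedge i) (pc_gen G i) = 0.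
Proof.
move=> /nbrP [h1 h2 _]; rewrite /wedge lie_leibniz.
rewrite (pc_gen_comm (x := nbr1 i)) 1?adj_sym // (pc_gen_comm (x := nbr2 i)) 1?adj_sym //.
by rewrite !lie0l subr0.
Qed.

Let wedge_neq0 i j : ~~ endpoint G i -> j != i ->
  lie (wedge i) (pc_gen G j) != 0.
Proof.
move=> hi nji; have [h1 h2 h12] := nbrP hi; have na := nadj h1 h2.
have [/andP[a1 a2]|] := boolP (~~ adj G j (nbr2 i) && (j != nbr2 i)).
  exact: bracket3_neq0.
rewrite negb_and !negbK => hj; rewrite /wedge [lie (pc_gen _ _) _]lieC.
rewrite lieNl oppr_eq0; apply: bracket3_neq0.
- by rewrite adj_sym.
- by rewrite eq_sym.
- case/orP: hj => [hj|/eqP ->]; last by rewrite adj_sym.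
  apply/negP => hj1; case/negP: (acyclic_separates gacyc h1 h2 h12).
  have n k : adj G i k -> k != i by move=> hk; apply: contraTneq hk => ->; rewrite adj_irr.
  apply: (connect_trans (y := j)); apply: connect1; rewrite /adj_in !inE nji ?n //.
  by rewrite adj_sym.
- case/orP: hj => [|/eqP ->]; last by rewrite eq_sym.
  by apply: contraTneq => ->.
Qed.

Let idx := [seq k <- enum {: X * X} |
  [&& ~~ endpoint G k.1, ~~ endpoint G k.2 & k.2 != k.1]].

(** The image of [wedge i] is killed by the image of [i], whose linear part is thus a
    multiple of one vertex [g i].  If [g] took the same value at two vertices [x] and
    [y], a combination of their images would have no linear part, and the image of
    [wedge x] would be killed by the image of [y]. *)
Lemma star_map_large : (exists i j, [/\ ~~ endpoint G i, ~~ endpoint G j & i != j]) ->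
  exists g : X -> Y,
  [/\ forall x, ~~ endpoint G x -> ~~ endpoint H (g x),
      forall x y, ~~ endpoint G x -> ~~ endpoint G y -> g x = g y -> x = y &
      forall x y, ~~ endpoint G x -> ~~ endpoint G y -> adj G x y -> adj H (g x) (g y)].
Proof.
move=> [i0 [j0 [hi0 hj0 nij0]]].
have [|f hf fnz] := hd (s := [seq lie (wedge k.1) (pc_gen G k.2) | k <- idx]).
  move=> u /mapP [[i j]]; rewrite mem_filter => /andP[/= /and3P[hi _ hij] _] ->.
  exact: wedge_neq0.
have fw i j : ~~ endpoint G i -> ~~ endpoint G j -> j != i ->
    lie (f (wedge i)) (f (pc_gen G j)) != 0.
  move=> hi hj nji; rewrite -(lie_morphL hf); apply: fnz.
  apply/mapP; exists (i, j) => //; by rewrite mem_filter mem_enum /= hi hj nji.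
have other i : exists2 j, ~~ endpoint G j & j != i.
  by have [<-|h] := eqVneq i0 i; [exists j0; rewrite 1?eq_sym | exists i0].
have fl i x : lin x (f (wedge i)) = 0 by rewrite (lie_morphL hf) lin_lie.
have fw0 i : ~~ endpoint G i -> f (wedge i) != 0.
  move=> hi; have [j hj nji] := other i.
  by apply: contraNneq (fw i j hi hj nji) => ->; rewrite lie0l.
have fk i : ~~ endpoint G i -> lie (f (wedge i)) (f (pc_gen G i)) = 0.
  by move=> hi; rewrite -(lie_morphL hf) wedge_kill // (lie_morph0 hf).
have ex i : ~~ endpoint G i -> exists y, lin y (f (pc_gen G i)) != 0.
  move=> hi; have [j hj nji] := other i.
  apply: contrapT => hno; have := fw j i hj hi; rewrite eq_sym => /(_ nji) /negP; apply.
  apply/eqP; apply: lin0_comm => // y; apply/eqP/negPn/negP => h.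
  by apply: hno; exists y.
have [y0 _] := ex i0 hi0.
pose g i := odflt y0 [pick y | lin y (f (pc_gen G i)) != 0].
have gP i : ~~ endpoint G i -> lin (g i) (f (pc_gen G i)) != 0.
  move=> hi; rewrite /g; case: pickP => // h.
  by have [y] := ex i hi; rewrite h.
have gV i (hi : ~~ endpoint G i) :=
  lie_eq0_vertex hacyc (fl i) (fw0 i hi) (fk i hi) (gP i hi).
have gz i y : ~~ endpoint G i -> y != g i -> lin y (f (pc_gen G i)) = 0.
  move=> hi hy; apply/eqP/negPn/negP => /((gV i hi).2) e.
  by rewrite e eqxx in hy.
have ginj x y : ~~ endpoint G x -> ~~ endpoint G y -> g x = g y -> x = y.
  move=> hx hy e; apply/eqP/negPn/negP => nxy.
  pose a := lin (g x) (f (pc_gen G x)); pose b := lin (g x) (f (pc_gen G y)).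
  have h0 z : lin z (f (pc_gen G y) *~ a - f (pc_gen G x) *~ b) = 0.
    rewrite linB !linMz; have [->|nz] := eqVneq z (g x).
      by rewrite /a /b mulrC subrr.
    by rewrite !gz ?mul0r ?subrr // -e.
  have := lin0_comm (fl x) h0; rewrite lieBr !lieMzr fk // mul0rz subr0 => ht.
  have := gP x hx; rewrite -/a => /negP; apply; apply/eqP.
  apply: lin0_torsionfree ht _ => [z|]; first exact: lin_lie.
  by apply: fw => //; rewrite eq_sym.
exists g; split=> [x hx|//|x y hx hy hxy].
  by rewrite /endpoint neq_ltn (gV x hx).1 orbT.
apply: (adj_of_comm (z := f (pc_gen G x)) (z' := f (pc_gen G y))).
- by rewrite -(lie_morphL hf) pc_gen_comm // (lie_morph0 hf).
- exact: gP.
- apply: gz => //; apply: contraTneq hxy => /(ginj _ _ hy hx) ->.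
  by rewrite adj_irr.
- exact: gP.
Qed.

(** With a single inner vertex there is nothing to preserve but non-commutativity,
    and a target tree without inner vertices would have an abelian ring. *)
Lemma star_map : exists g : X -> Y,
  [/\ forall x, ~~ endpoint G x -> ~~ endpoint H (g x),
      forall x y, ~~ endpoint G x -> ~~ endpoint G y -> g x = g y -> x = y &
      forall x y, ~~ endpoint G x -> ~~ endpoint G y -> adj G x y -> adj H (g x) (g y)].
Proof.
have [|small] := pselect (exists i j, [/\ ~~ endpoint G i, ~~ endpoint G j & i != j]).
  exact: star_map_large.
have {}small i j : ~~ endpoint G i -> ~~ endpoint G j -> i = j.
  by move=> hi hj; apply/eqP/negPn/negP => h; apply: small; exists i, j.
have [[i hi]|none] := pselect (exists i, ~~ endpoint G i); last first.
  have [y _] : exists y : Y, y \in Y by apply/card_gt0P; exact: ltnW.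
  exists (fun=> y); split=> [x hx|x z hx|x z hx]; by case: none; exists x.
have [y hy] : exists y, ~~ endpoint H y.
  apply: contrapT => none.
  have hend y : endpoint H y by apply/negPn/negP => h; apply: none; exists y.
  have [a [b [hab cover]]] := all_endpoints hconn hY hend.
  have abel : forall z z' : pc_metab H, lie z z' = 0.
    apply: pc_abelian => x x'.
    case: (cover x) (cover x') => -> [] ->; rewrite ?liexx // pc_gen_comm //.
    by rewrite adj_sym.
  have [h1 h2 h12] := nbrP hi.
  have [|f hf fnz] := hd (s := [:: wedge i]).
    move=> u; rewrite inE => /eqP ->.
    have /(wedge_neq0 hi) : nbr1 i != i by apply: contraTneq h1 => ->; rewrite adj_irr.
    by apply: contraNneq => ->; rewrite lie0l.
  by have := fnz _ (mem_head _ _); rewrite (lie_morphL hf) abel eqxx.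
exists (fun=> y); split=> // x z hx hz; first by move=> _; exact: small.
by rewrite (small x z) // adj_irr.
Qed.

End StarEmbedding.

(** * Isomorphic interiors give discrimination *)

Section CoreOfIso.
Variables (X Y : finType) (G : sgraph X) (H : sgraph Y).
Hypotheses (hG : is_tree G) (hH : is_tree H).
Hypotheses (hX : (2 <= #|X|)%N) (hY : (2 <= #|Y|)%N).

Let gconn := hG.1.
Let gacyc : acyclic G := hG.2.
Let hconn := hH.1.

Variables (F : X -> Y) (F' : Y -> X).
Hypothesis F_inner : forall x, ~~ endpoint G x -> ~~ endpoint H (F x).
Hypothesis F'_inner : forall y, ~~ endpoint H y -> ~~ endpoint G (F' y).
Hypothesis FK : forall x, ~~ endpoint G x -> F' (F x) = x.
Hypothesis F'K : forall y, ~~ endpoint H y -> F (F' y) = y.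
Hypothesis F_mono : forall x x', ~~ endpoint G x -> ~~ endpoint G x' ->
  adj H (F x) (F x') = adj G x x'.

Definition leaves (Z : finType) (T : sgraph Z) (c : Z) : seq Z :=
  enum [set x | endpoint T x && adj T c x].

Lemma mem_leaves (Z : finType) (T : sgraph Z) c x :
  (x \in leaves T c) = endpoint T x && adj T c x.
Proof. by rewrite mem_enum inE. Qed.

Let nb x := odflt x [pick c | adj G x c].

Let nbP x : adj G x (nb x).
Proof.
rewrite /nb; case: pickP => // h.
by have [y] := exists_adj gconn hX x; rewrite h.
Qed.

(** An inner vertex [c] keeps at most as many of its endpoints as [F c] has, matched
    by their positions in the two lists.  If one is left out, all endpoints at [F c]
    are matched, so [c] has in the core as many neighbours as [F c]. *)
Let pos x := index x (leaves G (nb x)).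
Let core := [set x | ~~ endpoint G x || (pos x < size (leaves H (F (nb x))))%N].
Let emb x := if endpoint G x then nth (F x) (leaves H (F (nb x))) (pos x) else F x.

(** A tree without inner vertices is a single edge, and is embedded as such. *)
Lemma discriminates_of_inner_iso : discriminates (pc_metab G) (pc_metab H).
Proof.
have [[c0 hc0]|none] := pselect (exists c, ~~ endpoint G c); last first.
  have endG x : endpoint G x by apply/negPn/negP => h; apply: none; exists x.
  have endH y : endpoint H y.
    by apply/negPn/negP => /F'_inner; rewrite endG.
  have [a [b [hab cov]]] := all_endpoints gconn hX endG.
  have [a' [b' [hab' _]]] := all_endpoints hconn hY endH.
  have neq (Z : finType) (T : sgraph Z) x y : adj T x y -> y != x.
    by move=> h; apply: contraTneq h => ->; rewrite adj_irr.
  pose g x := if x == a then a' else b'.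
  apply: (@core_discriminates _ _ gacyc [set: X] _ _ _ g) => [l|x y _ _|x y _ _].
  - by rewrite inE.
  - case: (cov x) (cov y) => -> [] ->; rewrite /g ?eqxx ?(negbTE (neq _ _ _ _ hab)) //.
      by move=> e; rewrite e adj_irr in hab'.
    by move=> e; rewrite e adj_irr in hab'.
  - case: (cov x) (cov y) => -> [] ->;
      rewrite /g ?eqxx ?(negbTE (neq _ _ _ _ hab)) ?adj_irr ?hab ?hab' //.
    by rewrite adj_sym hab' adj_sym hab.
have nb_inner x : endpoint G x -> ~~ endpoint G (nb x).
  move=> hx; apply/negP => hn.
  have := adjacent_endpoints gconn (nbP x) hx hn c0.
  by case=> e; rewrite e ?hx ?hn in hc0.
have leafP x : endpoint G x -> x \in leaves G (nb x).
  by move=> hx; rewrite mem_leaves hx adj_sym nbP.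
have embL x : endpoint G x -> x \in core -> emb x \in leaves H (F (nb x)).
  by move=> hx; rewrite inE /emb hx /= => h; exact: mem_nth.
apply: (@core_discriminates _ _ gacyc core _ _ _ emb).
- move=> l; rewrite inE negb_or negbK -leqNgt => /andP[hl hpos].
  set c := nb l in hpos; have hc : ~~ endpoint G c by exact: nb_inner.
  have hlt : (size (leaves H (F c)) <= size (leaves G c))%N.
    by apply: leq_trans hpos _; exact: index_size.
  (* The neighbours of [F c] are carried into the core, so that two of them give the
     two neighbours of [c] into which [l] is absorbed. *)
  pose h z := if endpoint H z then nth c (leaves G c) (index z (leaves H (F c))) else F' z.
  have hleaf z : adj H (F c) z -> endpoint H z -> h z \in leaves G c /\
      (index (h z) (leaves G c) = index z (leaves H (F c))).
    move=> hz ez; rewrite /h ez.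
    have lt : (index z (leaves H (F c)) < size (leaves G c))%N.
      by apply: leq_trans hlt; rewrite index_mem mem_leaves ez.
    by rewrite mem_nth // index_uniq // enum_uniq.
  have hendE z : adj H (F c) z -> endpoint G (h z) = endpoint H z.
    move=> hz; have [ez|ez] := boolP (endpoint H z).
      by have [] := hleaf z hz ez; rewrite mem_leaves => /andP[].
    by rewrite /h (negbTE ez) (negbTE (F'_inner ez)).
  have hadj z : adj H (F c) z -> adj G c (h z).
    move=> hz; have [ez|ez] := boolP (endpoint H z).
      by have [] := hleaf z hz ez; rewrite mem_leaves => /andP[].
    by rewrite /h (negbTE ez) -F_mono ?F'_inner // F'K.
  have hcore z : adj H (F c) z -> h z \in core.
    move=> hz; rewrite inE hendE //; have [ez|//] := boolP (endpoint H z).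
    have enb : nb (h z) = c.
      by apply: endpoint_uniq (nbP _) _; rewrite ?hendE // adj_sym hadj.
    have [_ hi] := hleaf z hz ez.
    by rewrite /= /pos enb hi index_mem mem_leaves ez.
  have hinj z z' : adj H (F c) z -> adj H (F c) z' -> h z = h z' -> z = z'.
    move=> hz hz' e; have := hendE z hz; rewrite e hendE //.
    case ez: (endpoint H z) => ez'; last first.
      by move: e; rewrite /h ez ez' => e; rewrite -[z]F'K ?ez // e F'K // ez'.
    have [_ i1] := hleaf z hz ez; have [_ i2] := hleaf z' hz' ez'.
    have mz : z \in leaves H (F c) by rewrite mem_leaves ez.
    have mz' : z' \in leaves H (F c) by rewrite mem_leaves ez'.
    by rewrite -(nth_index z mz) -i1 e i2 nth_index.
  have [z1 [z2 [hz1 hz2 nz]]] :=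
    degree_gt1P (degree_gt1 hconn hY (F_inner hc)).
  exists c, (h z1), (h z2); split.
  + exact: nbP.
  + by move=> x hx; exact: endpoint_uniq hl hx (nbP l).
  + by rewrite !hadj.
  + by apply: contraNneq nz => /(hinj _ _ hz1 hz2) ->.
  + by rewrite !hcore.
- move=> x x' hx hx'.
  case ex: (endpoint G x); case ex': (endpoint G x').
  + move=> e; have := embL x ex hx; rewrite e mem_leaves => /andP[e1 a1].
    have := embL x' ex' hx'; rewrite mem_leaves => /andP[_ a2].
    have eF : F (nb x) = F (nb x').
      by apply: (endpoint_uniq e1); rewrite adj_sym.
    have en : nb x = nb x' by rewrite -[nb x]FK ?nb_inner // eF FK ?nb_inner.
    move: e; rewrite /emb ex ex' -en => /eqP.
    move: hx hx'; rewrite !inE ex ex' /= -en => hx hx'.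
    rewrite (set_nth_default (F x)) // nth_uniq ?enum_uniq // /pos -en => /eqP e.
    by rewrite -(nth_index x (leafP x ex)) e en nth_index // leafP.
  + move=> e; have := embL x ex hx; rewrite e mem_leaves /emb ex' => /andP[].
    by rewrite (negbTE (F_inner (negbT ex'))).
  + move=> e; have := embL x' ex' hx'; rewrite -e mem_leaves /emb ex => /andP[].
    by rewrite (negbTE (F_inner (negbT ex))).
  + by rewrite /emb ex ex' => e; rewrite -[x]FK ?ex // e FK // ex'.
- have cross x x' : x' \in core -> endpoint G x' -> ~~ endpoint G x ->
      adj H (F x) (emb x') = adj G x x'.
    move=> hx' ex' ex; have := embL x' ex' hx'; rewrite mem_leaves => /andP[e1 a1].
    apply/idP/idP => [a2|a2].
      have -> : x = nb x'; last by rewrite adj_sym nbP.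
      rewrite -[x]FK // -[nb x']FK ?nb_inner //; congr F'.
      by apply: (endpoint_uniq e1); rewrite adj_sym.
    have -> // : x = nb x'.
    by apply: (endpoint_uniq ex' _ (nbP x')); rewrite adj_sym.
  move=> x x' hx hx'.
  case ex: (endpoint G x); case ex': (endpoint G x').
  + have := embL x ex hx; rewrite mem_leaves => /andP[e1 a1].
    have := embL x' ex' hx'; rewrite mem_leaves => /andP[e1' a1'].
    transitivity false; last first.
      apply/esym/negbTE/negP => h; have := nb_inner x ex.
      by rewrite (endpoint_uniq ex (nbP x) h) ex'.
    apply/negbTE/negP => h; have := F_inner (nb_inner x ex).
    have -> : F (nb x) = emb x' by apply: (endpoint_uniq e1 _ h); rewrite adj_sym.
    by rewrite e1'.
  + have -> : emb x' = F x' by rewrite /emb ex'.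
    rewrite (adj_sym H) (adj_sym G).
    by apply: cross; rewrite ?ex'.
  + have -> : emb x = F x by rewrite /emb ex.
    by apply: cross; rewrite ?ex.
  + by rewrite /emb ex ex' F_mono ?ex ?ex'.
Qed.

End CoreOfIso.

(** * Comparing the two trees *)

(** Injective edge-preserving maps in both directions are isomorphisms, by counting
    vertices and then edges. *)
Lemma iso_of_embeddings (V W : finType) (A : sgraph V) (B : sgraph W)
    (f : V -> W) (g : W -> V) :
  injective f -> injective g ->
  {homo f : x y / adj A x y >-> adj B x y} ->
  {homo g : x y / adj B x y >-> adj A x y} ->
  graph_isomorphic A B.
Proof.
move=> fi gi fh gh.
have le_VW : (#|V| <= #|W|)%N := leq_card f fi.
have le_WV : (#|W| <= #|V|)%N := leq_card g gi.
exists f; first by apply: inj_card_bij.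
pose EA := [set e : V * V | adj A e.1 e.2].
pose EB := [set e : W * W | adj B e.1 e.2].
pose f2 (e : V * V) := (f e.1, f e.2); pose g2 (e : W * W) := (g e.1, g e.2).
have f2i : injective f2 by move=> [a b] [a' b'] [/fi -> /fi ->].
have g2i : injective g2 by move=> [a b] [a' b'] [/gi -> /gi ->].
have leBA : (#|EB| <= #|EA|)%N.
  rewrite -(card_imset EB g2i); apply/subset_leq_card/subsetP => _ /imsetP [e he ->].
  by move: he; rewrite !inE; exact: gh.
have eq_im : f2 @: EA = EB.
  apply/eqP; rewrite eqEcard card_imset // leBA andbT.
  apply/subsetP => _ /imsetP [e he ->].
  by move: he; rewrite !inE; exact: fh.
move=> x y; apply/idP/idP => [h|]; last exact: fh.
have : (f x, f y) \in EB by rewrite inE.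
by rewrite -eq_im => /imsetP [[a b]]; rewrite inE => /= hab [/fi -> /fi ->].
Qed.

Lemma star_embedding (X Y : finType) (G : sgraph X) (H : sgraph Y) :
  is_tree G -> is_tree H -> (2 <= #|X|)%N -> (2 <= #|Y|)%N ->
  discriminates (pc_metab G) (pc_metab H) ->
  exists2 f : {x | x \in [set x | ~~ endpoint G x]} ->
              {y | y \in [set y | ~~ endpoint H y]},
    injective f & {homo f : x y / adj (star G) x y >-> adj (star H) x y}.
Proof.
move=> hG hH hX hY /(star_map hG hH hX hY) [g [gV ginj gadj]].
have mem (Z : finType) (T : sgraph Z) (z : {z | z \in [set z | ~~ endpoint T z]}) :
  ~~ endpoint T (val z) by have := valP z; rewrite inE.
have gin (x : {x | x \in [set x | ~~ endpoint G x]}) :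
    g (val x) \in [set y | ~~ endpoint H y].
  by rewrite inE; apply: gV; exact: mem.
exists (fun x => Sub (g (val x)) (gin x)).
  by move=> x y [/ginj e]; apply: val_inj; apply: e; exact: mem.
by move=> x y; apply: gadj; exact: mem.
Qed.

Lemma star_iso_discriminates (X Y : finType) (G : sgraph X) (H : sgraph Y) :
  is_tree G -> is_tree H -> (2 <= #|X|)%N -> (2 <= #|Y|)%N ->
  graph_isomorphic (star G) (star H) ->
  discriminates (pc_metab G) (pc_metab H).
Proof.
move=> hG hH hX hY [f [f' fK f'K] fmono].
have [x0 _] : exists x : X, x \in X by apply/card_gt0P; exact: ltnW.
have [y0 _] : exists y : Y, y \in Y by apply/card_gt0P; exact: ltnW.
pose F x := if insub x is Some u then val (f u) else y0.
pose F' y := if insub y is Some v then val (f' v) else x0.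
have FE x (hx : x \in [set x | ~~ endpoint G x]) : F x = val (f (Sub x hx)).
  by rewrite /F insubT.
have F'E y (hy : y \in [set y | ~~ endpoint H y]) : F' y = val (f' (Sub y hy)).
  by rewrite /F' insubT.
have inG x : ~~ endpoint G x -> x \in [set x | ~~ endpoint G x] by rewrite inE.
have inH y : ~~ endpoint H y -> y \in [set y | ~~ endpoint H y] by rewrite inE.
apply: (@discriminates_of_inner_iso _ _ _ _ hG hH hX hY F F').
- by move=> x /inG hx; rewrite FE; have := valP (f (Sub x hx)); rewrite inE.
- by move=> y /inH hy; rewrite F'E; have := valP (f' (Sub y hy)); rewrite inE.
- by move=> x /inG hx; rewrite FE /F' valK fK.
- by move=> y /inH hy; rewrite F'E /F valK f'K.
- move=> x x' /inG hx /inG hx'; rewrite !FE.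
  exact: (fmono (Sub x hx) (Sub x' hx')).
Qed.

Lemma graph_isomorphic_sym (V W : finType) (A : sgraph V) (B : sgraph W) :
  graph_isomorphic A B -> graph_isomorphic B A.
Proof.
move=> [f [g fK gK] fm]; exists g; first by exists f.
by move=> x y; rewrite -fm !gK.
Qed.

Theorem theorem5p9 (X Y : finType) (T1 : sgraph X) (T2 : sgraph Y)
    (hX : (2 <= #|X|)%N) (hY : (2 <= #|Y|)%N)
    (hT1 : is_tree T1) (hT2 : is_tree T2) :
  universally_equivalent (pc_metab T1) (pc_metab T2) <->
  graph_isomorphic (star T1) (star T2).
Proof.
split=> [hu|hiso s].
- have d12 : discriminates (pc_metab T1) (pc_metab T2).
    by apply: us_holds_discriminates; [exact: pc_metabelian | move=> s /hu].
  have d21 : discriminates (pc_metab T2) (pc_metab T1).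
    by apply: us_holds_discriminates; [exact: pc_metabelian | move=> s /hu].
  have [f fi fh] := star_embedding hT1 hT2 hX hY d12.
  have [g gi gh] := star_embedding hT2 hT1 hY hX d21.
  exact: iso_of_embeddings fi gi fh gh.
- have d12 := star_iso_discriminates hT1 hT2 hX hY hiso.
  have d21 := star_iso_discriminates hT2 hT1 hY hX (graph_isomorphic_sym hiso).
  by split; apply: discriminates_us_holds.
Qed.
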